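(* Let $N$ be a $4$-dimensional neutral space form of constant sectional curvature $L_0$, $M$ a Lorentz surface and $F:M\to N$ a time-like and conformal immersion whose normal connection $\nabla^{\perp}$ is flat. Let $K$ be the curvature of the induced metric. (a) Suppose that $K$ is nowhere equal to $L_0$. Then on a neighborhood of each point of $M$, $F$ has a space-like (respectively, time-like) parallel normal vector field if and only if the second fundamental form $\sigma$ of $F$ satisfies the space-like (respectively, time-like) linearly dependent condition. In addition, if one of these conditions holds, then $\gamma-t_+$ (respectively, $\gamma-t_-$) is constant. (b) Suppose $K\equiv L_0$. Then on a neighborhood of each point of $M$, $F$ has a space-like (respectively, time-like) parallel normal vector field if and only if $\sigma$ satisfies the space-like (respectively, time-like) linearly dependent condition with $t_+$ (respectively, $t_-$) such that $\gamma-t_+$ (respectively, $\gamma-t_-$) is constant. If $F$ has a space-like (respectively, time-like) parallel normal vector field, then, up to a nonzero constant factor, it is given by $e^{-\lambda}(\cosh t_+\,N_1-\sinh t_+\,N_2)$ (respectively, $e^{-\lambda}(\sinh t_-\,N_1-\cosh t_-\,N_2)$), with $t_\pm$ as in (a), respectively (b).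
   Context: All objects are smooth. ''Neutral'' means signature $(2,2)$; $h$ is the metric of $N$, $\nabla$ its Levi-Civita connection. Everything is local: $(u,v)$ are local coordinates of $M$ compatible with its paracomplex structure on a simply connected domain, with induced metric $g=e^{2\lambda}(du^2-dv^2)$; $T_1=dF(\partial_u)$, $T_2=dF(\partial_v)$; $N_1,N_2$ are normal vector fields with $h(N_1,N_1)=-h(N_2,N_2)=e^{2\lambda}$, $h(N_1,N_2)=0$. The real functions $\alpha_k,\beta_k,\mu_l$ are defined by: the normal components of $\nabla_{T_1}T_1$, $\nabla_{T_1}T_2$, $\nabla_{T_2}T_2$ are $\alpha_1N_1+\beta_1N_2$, $\alpha_2N_1+\beta_2N_2$, $\alpha_3N_1+\beta_3N_2$; and $\nabla^{\perp}_{T_1}N_1=\lambda_uN_1+\mu_1N_2$, $\nabla^{\perp}_{T_1}N_2=\mu_1N_1+\lambda_uN_2$, $\nabla^{\perp}_{T_2}N_1=\lambda_vN_1+\mu_2N_2$, $\nabla^{\perp}_{T_2}N_2=\mu_2N_1+\lambda_vN_2$. Flatness of $\nabla^{\perp}$ is $R^{\perp}\equiv0$, equivalently $(\mu_1)_v=(\mu_2)_u$; $\gamma$ is a function with $\gamma_u=\mu_1$, $\gamma_v=\mu_2$. $\sigma$ satisfies the space-like linearly dependent condition if $\cosh t_+\,(\alpha_1,\alpha_2,\alpha_3)+\sinh t_+\,(\beta_1,\beta_2,\beta_3)=(0,0,0)$ for a function $t_+$ of $(u,v)$, and the time-like linearly dependent condition if $\sinh t_-\,(\alpha_1,\alpha_2,\alpha_3)+\cosh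 t_-\,(\beta_1,\beta_2,\beta_3)=(0,0,0)$ for a function $t_-$ of $(u,v)$. A parallel normal vector field is a nowhere zero normal vector field $\xi$ of $F$ with $\nabla\xi=0$ for the Levi-Civita connection of $N$. *)

(* Defs.v *)
From HB Require Import structures.
From mathcomp Require Import all_boot all_order all_algebra.
From mathcomp Require Import all_classical all_reals all_analysis.

Set Implicit Arguments.
Unset Strict Implicit.
Unset Printing Implicit Defensive.

Import Order.TTheory GRing.Theory Num.Theory.
Import numFieldNormedType.Exports.

Local Open Scope classical_set_scope.
Local Open Scope ring_scope.

Section Calculus.
Context {R : realType}.

Definition cosh (x : R) : R := (expR x + expR (- x)) / 2.
Definition sinh (x : R) : R := (expR x - expR (- x)) / 2.

Definition partial m (W : normedModType R) (k : 'I_m) (f : 'rV[R]_m -> W)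
  (x : 'rV[R]_m) : W := 'D_(delta_mx 0 k) f x.

(* Only used for open A, where it is the usual class C^r: a map with continuous
   partial derivatives is differentiable, so the Frechet differentiability asked
   at each positive order is not an extra condition. *)
Fixpoint Cr m (W : normedModType R) (r : nat) (A : set 'rV[R]_m)
    (f : 'rV[R]_m -> W) : Prop :=
  match r with
  | 0 => forall x, A x -> {for x, continuous f}
  | r'.+1 => (forall x, A x -> differentiable f x) /\
             (forall k : 'I_m, Cr r' A (partial k f))
  end.

Definition smooth m (W : normedModType R) (A : set 'rV[R]_m)
  (f : 'rV[R]_m -> W) : Prop := forall r, Cr r A f.

Definition simply_connected m (D : set 'rV[R]_m) : Prop :=
  forall c : R -> 'rV[R]_m,
    {within `[0, 1]%classic, continuous c} -> (forall s, s \in `[0, 1] -> D (c s)) ->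
    c 0 = c 1 ->
  exists H : R * R -> 'rV[R]_m,
    [/\ {within `[0, 1]%classic `*` `[0, 1]%classic, continuous H},
        forall s t, s \in `[0, 1] -> t \in `[0, 1] -> D (H (s, t)),
        forall s, s \in `[0, 1] -> H (s, 0) = c s /\ H (s, 1) = c 0 &
        forall t, t \in `[0, 1] -> H (0, t) = c 0 /\ H (1, t) = c 0].

End Calculus.

(* A metric on (an open part of) R^n is given by the matrix h x of its
   coefficients at x; tangent vectors are rows. *)
Section MetricInCoordinates.
Context {R : realType} {n : nat}.
Implicit Types (h : 'rV[R]_n -> 'M[R]_n) (x a b c : 'rV[R]_n).

Definition inner (G : 'M[R]_n) a b : R := (a *m G *m b^T) 0 0.

(* Gamma^l_{ij} *)
Definition christoffel h x (l i j : 'I_n) : R :=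
  2^-1 * \sum_(m < n) invmx (h x) l m *
    (partial i (fun y => h y j m) x + partial j (fun y => h y i m) x
     - partial m (fun y => h y i j) x).

Definition christoffel_form h x a b : 'rV[R]_n :=
  \row_l \sum_(i < n) \sum_(j < n) christoffel h x l i j * a 0 i * b 0 j.

(* The l-th component of R(d_i, d_j) d_k, for
   R(X, Y) = [nabla_X, nabla_Y] - nabla_[X, Y]. *)
Definition riemann h x (l i j k : 'I_n) : R :=
  partial i (fun y => christoffel h y l j k) x
  - partial j (fun y => christoffel h y l i k) x
  + \sum_(m < n) (christoffel h x l i m * christoffel h x m j k
                  - christoffel h x l j m * christoffel h x m i k).

Definition curvature h x a b c : 'rV[R]_n :=
  \row_l \sum_(i < n) \sum_(j < n) \sum_(k < n)
    riemann h x l i j k * a 0 i * b 0 j * c 0 k.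

Definition plane_det h x a b : R :=
  inner (h x) a a * inner (h x) b b - inner (h x) a b ^+ 2.

Definition sectional h x a b : R :=
  inner (h x) (curvature h x a b b) a / plane_det h x a b.

End MetricInCoordinates.

Definition gauss_curvature (R : realType) (g : 'rV[R]_2 -> 'M[R]_2)
  (p : 'rV[R]_2) : R := sectional g p (delta_mx 0 0) (delta_mx 0 1).

(* A smooth pseudo-Riemannian manifold of dimension n, presented by an atlas.
   [param i] is the inverse of [chart i], and [metric i] the metric read in
   [chart i], as a function of the coordinates. *)
Record pseudoRiemannian (R : realType) (n : nat) := PseudoRiemannian {
  carrier :> topologicalType;
  chart_index : Type;
  chart_dom : chart_index -> set carrier;
  chart : chart_index -> carrier -> 'rV[R]_n;
  param : chart_index -> 'rV[R]_n -> carrier;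
  metric : chart_index -> 'rV[R]_n -> 'M[R]_n;
  carrier_hausdorff : hausdorff_space carrier;
  carrier_second_countable : @second_countable carrier;
  chart_cover : forall q : carrier, exists i, chart_dom i q;
  chart_dom_open : forall i, open (chart_dom i);
  chart_cod_open : forall i, open (chart i @` chart_dom i);
  chartK : forall i q, chart_dom i q -> param i (chart i q) = q;
  chart_continuous : forall i q, chart_dom i q -> {for q, continuous (chart i)};
  param_continuous : forall i x, (chart i @` chart_dom i) x ->
    {for x, continuous (param i)};
  transition_smooth : forall i j,
    smooth (chart i @` (chart_dom i `&` chart_dom j)) (chart j \o param i);
  metric_smooth : forall i, smooth (chart i @` chart_dom i) (metric i);
  metric_sym : forall i x, (chart i @` chart_dom i) x ->
    (metric i x)^T = metric i x;
  metric_nondegenerate : forall i x, (chart i @` chart_dom i) x ->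
    metric i x \in unitmx;
  metric_transition : forall i j q, chart_dom i q -> chart_dom j q ->
    forall a b : 'rV[R]_n,
      inner (metric i (chart i q)) a b =
      inner (metric j (chart j q)) ('D_a (chart j \o param i) (chart i q))
                                   ('D_b (chart j \o param i) (chart i q))
}.

Section SpaceForm.
Context {R : realType}.

Definition neutral (N : pseudoRiemannian R 4) : Prop :=
  forall (i : chart_index N) q, chart_dom i q ->
  exists2 P : 'M[R]_4, P \in unitmx &
    P *m metric i (chart i q) *m P^T
    = diag_mx (\row_(k < 4) (if (k < 2)%N then 1 else -1)).

Definition constant_curvature n (N : pseudoRiemannian R n) (L0 : R) : Prop :=
  forall (i : chart_index N) q, chart_dom i q ->
  forall a b : 'rV[R]_n, plane_det (metric i) (chart i q) a b != 0 ->
    sectional (metric i) (chart i q) a b = L0.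

Definition neutral_space_form (N : pseudoRiemannian R 4) (L0 : R) : Prop :=
  neutral N /\ constant_curvature N L0.

End SpaceForm.

(* Vector fields of N along a map F from a domain V of the (u, v)-plane, where
   u = p 0 0 and v = p 0 1: X i p is the tangent vector at F p read in the
   chart i.  It is meaningful only when F p lies in the domain of this chart,
   and its readings in two charts are related by the differential of the
   transition map. *)
Section AlongMap.
Context {R : realType} {n : nat} (N : pseudoRiemannian R n).
Implicit Types (F : 'rV[R]_2 -> N) (V : set 'rV[R]_2).

Definition field := chart_index N -> 'rV[R]_2 -> 'rV[R]_n.
Implicit Types X Y : field.

Definition smooth_map V F : Prop :=
  (forall p, V p -> {for p, continuous F}) /\
  (forall i : chart_index N,
     smooth (V `&` F @^-1` chart_dom i) (chart i \o F)).

(* P i p for every p in V and every chart i around F p *)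
Definition in_charts V F (P : chart_index N -> 'rV[R]_2 -> Prop) : Prop :=
  forall i p, V p -> chart_dom i (F p) -> P i p.

Definition field_along V F X : Prop :=
  (forall i, smooth (V `&` F @^-1` chart_dom i) (X i)) /\
  (forall i j p, V p -> chart_dom i (F p) -> chart_dom j (F p) ->
     X j p = 'D_(X i p) (chart j \o param i) (chart i (F p))).

Definition h_along F X Y (i : chart_index N) (p : 'rV[R]_2) : R :=
  inner (metric i (chart i (F p))) (X i p) (Y i p).

(* T_1 = dF(d_u) for k = 0 and T_2 = dF(d_v) for k = 1 *)
Definition tangent F (k : 'I_2) : field :=
  fun i => partial k (chart i \o F).

(* The covariant derivative of N along F in the direction T_k *)
Definition nabla F (k : 'I_2) X : field :=
  fun i p => partial k (X i) p +
    christoffel_form (metric i) (chart i (F p)) (tangent F k i p) (X i p).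

Definition normal V F X : Prop :=
  in_charts V F (fun i p => forall k, h_along F X (tangent F k) i p = 0).

(* The normal component of X along F, where g is the induced metric *)
Definition normal_part F (g : 'rV[R]_2 -> 'M[R]_2) X : field :=
  fun i p => X i p - \sum_(a < 2) \sum_(b < 2)
    (invmx (g p) a b * h_along F X (tangent F a) i p) *: tangent F b i p.

Definition nabla_perp F g (k : 'I_2) X : field := normal_part F g (nabla F k X).

(* sigma(T_a, T_b) *)
Definition second_form F g (a b : 'I_2) : field :=
  normal_part F g (nabla F a (tangent F b)).

(* R^perp = 0; the coordinate fields d_u and d_v commute. *)
Definition flat_normal_connection V F g : Prop :=
  forall X, field_along V F X -> normal V F X ->
  in_charts V F (fun i p =>
    nabla_perp F g 0 (nabla_perp F g 1 X) i p
    = nabla_perp F g 1 (nabla_perp F g 0 X) i p).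

Definition parallel_normal V F X : Prop :=
  [/\ field_along V F X, normal V F X,
      in_charts V F (fun i p => X i p != 0) &
      in_charts V F (fun i p => forall k, nabla F k X i p = 0)].

End AlongMap.

Section Surface.
Context {R : realType} (N : pseudoRiemannian R 4).
Implicit Types (F : 'rV[R]_2 -> N) (D V : set 'rV[R]_2).
Implicit Types (lambda t : 'rV[R]_2 -> R).

(* e^{2 lambda} (du^2 - dv^2) *)
Definition lorentz_metric lambda (p : 'rV[R]_2) : 'M[R]_2 :=
  expR (2 * lambda p) *: diag_mx (\row_(k < 2) (-1) ^+ k).

(* Since the induced metric is nondegenerate, F is an immersion. *)
Definition timelike_conformal_immersion D F lambda : Prop :=
  [/\ smooth_map D F, smooth D lambda &
      in_charts D F (fun i p => forall a b : 'I_2,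
        h_along F (tangent F a) (tangent F b) i p = lorentz_metric lambda p a b)].

Definition normal_frame D F lambda (N1 N2 : field N) : Prop :=
  [/\ field_along D F N1 /\ field_along D F N2, normal D F N1 /\ normal D F N2 &
      in_charts D F (fun i p =>
        [/\ h_along F N1 N1 i p = expR (2 * lambda p),
            h_along F N2 N2 i p = - expR (2 * lambda p) &
            h_along F N1 N2 i p = 0])].

(* (alpha_1, alpha_2, alpha_3) and (beta_1, beta_2, beta_3) are the rows
   alpha p and beta p, with indices shifted to 0, 1, 2. *)
Definition second_form_coefficients D F lambda (N1 N2 : field N)
    (alpha beta : 'rV[R]_2 -> 'rV[R]_3) : Prop :=
  let sigma := second_form F (lorentz_metric lambda) in
  [/\ smooth D alpha, smooth D beta &
      in_charts D F (fun i p =>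
        [/\ sigma 0 0 i p
              = alpha p 0 0 *: N1 i p + beta p 0 0 *: N2 i p,
            sigma 0 1 i p
              = alpha p 0 1 *: N1 i p + beta p 0 1 *: N2 i p &
            sigma 1 1 i p
              = alpha p 0 2%:R *: N1 i p + beta p 0 2%:R *: N2 i p])].

Definition normal_connection_coefficients D F lambda (N1 N2 : field N)
    (mu1 mu2 : 'rV[R]_2 -> R) : Prop :=
  let nabla' := nabla_perp F (lorentz_metric lambda) in
  [/\ smooth D mu1, smooth D mu2 &
      in_charts D F (fun i p =>
        [/\ nabla' 0 N1 i p = partial 0 lambda p *: N1 i p + mu1 p *: N2 i p,
            nabla' 0 N2 i p = mu1 p *: N1 i p + partial 0 lambda p *: N2 i p,
            nabla' 1 N1 i p = partial 1 lambda p *: N1 i p + mu2 p *: N2 i p &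
            nabla' 1 N2 i p = mu2 p *: N1 i p + partial 1 lambda p *: N2 i p])].

Definition potential D (mu1 mu2 gamma : 'rV[R]_2 -> R) : Prop :=
  smooth D gamma /\
  forall p, D p -> partial 0 gamma p = mu1 p /\ partial 1 gamma p = mu2 p.

Inductive causal := spacelike | timelike.

Definition has_causal (c : causal) V F (X : field N) : Prop :=
  in_charts V F (fun i p =>
    match c with
    | spacelike => 0 < h_along F X X i p
    | timelike => h_along F X X i p < 0
    end).

Definition parallel_normal_of (c : causal) V F (X : field N) : Prop :=
  parallel_normal V F X /\ has_causal c V F X.

(* The space-like (time-like) linearly dependent condition on V, with the
   function t = t_+ (t = t_-) *)
Definition linearly_dependent (c : causal) V
    (alpha beta : 'rV[R]_2 -> 'rV[R]_3) t : Prop :=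
  smooth V t /\
  forall p, V p ->
    match c with
    | spacelike => cosh (t p) *: alpha p + sinh (t p) *: beta p = 0
    | timelike => sinh (t p) *: alpha p + cosh (t p) *: beta p = 0
    end.

Definition parallel_model (c : causal) lambda (N1 N2 : field N) t : field N :=
  fun i p => expR (- lambda p) *:
    match c with
    | spacelike => cosh (t p) *: N1 i p - sinh (t p) *: N2 i p
    | timelike => sinh (t p) *: N1 i p - cosh (t p) *: N2 i p
    end.

Definition proportional V F (X Y : field N) : Prop :=
  exists2 r : R, r != 0 & in_charts V F (fun i p => X i p = r *: Y i p).

Definition constant_on V (f : 'rV[R]_2 -> R) : Prop :=
  exists r : R, forall p, V p -> f p = r.

End Surface.

(* Main.v *)
Require Import Defs.
From HB Require Import structures.
From mathcomp Require Import all_boot all_order all_algebra.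
From mathcomp Require Import all_classical all_reals all_analysis.
From mathcomp Require Import ring lra.

Import Order.TTheory GRing.Theory Num.Theory.
Import numFieldNormedType.Exports.

Local Open Scope classical_set_scope.
Local Open Scope ring_scope.

Set Implicit Arguments.
Unset Strict Implicit.
Unset Printing Implicit Defensive.

(** Write E = exp (2 lambda) and l_k for the derivatives of lambda. The frame
    T_1, T_2, N_1, N_2 is orthogonal with squares E, -E, E, -E, so a vector is
    determined by its four products with the frame (orthogonal_frame_expansion,
    frame_eq0), and metric compatibility (partial_inner) turns products with
    covariant derivatives into derivatives of functions. The whole geometry is
    thereby reduced to equations between functions of (u, v).

    A normal field xi becomes the pair y1 = h(xi, N_1), y2 = h(xi, N_2). The
    products of its covariant derivative in the direction k with T_b, N_1 and
    N_2 are - (y1 alpha_kb + y2 beta_kb), d_k y1 - l_k y1 - mu_k y2 and d_k y2 -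
    mu_k y1 - l_k y2 (nabla_T, nabla_N1, nabla_N2). In the null coordinates p =
    exp (- lambda) (y1 + y2) and q = exp (- lambda) (y1 - y2), a parallel field
    therefore satisfies d_k p = mu_k p, d_k q = - mu_k q and is orthogonal to
    the second fundamental form. The product p q has the sign of h(xi, xi), so p
    / q is exp (2 t) up to this sign, for a function t. Then d_k t = mu_k and p
    exp (- t) is constant, which says that xi is a constant multiple of the
    model field with angle t and that gamma - t is constant (parallel_angle).
    Conversely, the model field with angle t is parallel as soon as the linearly
    dependent condition holds with t and d_k t = mu_k (model_parallel). Part (b)
    follows.

    Part (a) also needs that the linearly dependent condition alone forces d_k t
    = mu_k when K differs from L0 (dependent_partial). Let xi be the model field
    with angle t and eta the other unit normal. The condition says that sigma
    (T_a, T_b) = r_ab eta for some functions r_ab, while nabla_k xi is d_k t -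
    mu_k times eta, up to a common factor. The Codazzi equations become r_1b
    (d_0 t - mu_0) = r_0b (d_1 t - mu_1) for b = 0, 1, with the indices 0 and 1
    for u and v. The Gauss equation (gauss_relation) says that the determinant
    r_00 r_11 - r_01 ^ 2 is E (K - L0) up to sign and a positive factor, hence
    nonzero, and both d_k t - mu_k vanish. The Gauss equation also shows that
    sigma has no zero when K differs from L0, so that the direction of a
    parallel field is determined by the linearly dependent condition
    (dependent_proportional).

    The equations of Gauss and Codazzi come from the commutator of covariant
    derivatives along a map (cov_commutator), which rests on the symmetry of
    second derivatives (schwarz). Constant curvature enters through the value of
    the sectional curvature on the tangent plane, and through the vanishing of
    h(R(T_1, T_2) T_b, n) for n normal, which is obtained from it by
    polarization (constant_curvature_orthogonal). *)

(** * Derivatives of matrix-valued functions *)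

(** The difference of f and g vanishes near x, so it is absorbed by the
    remainder in the first-order expansion of f. *)
Lemma near_eq_differentiable (R : numFieldType) (V W : normedModType R)
    (f g : V -> W) (x : V) :
  (\near x, f x = g x) -> differentiable f x -> differentiable g x.
Proof.
move=> fg df; have fgx := nbhs_singleton fg.
have key : g \o shift x = cst (g x) + 'd f x +o_ 0 id.
  apply/eqaddoP => /= e e0.
  have /eqaddoP /(_ e e0) := diff_locally df.
  have fg0 : \forall y \near 0, f (shift x y) = g (shift x y).
    by move: fg; rewrite (near_shift 0) subr0.
  apply: filterS2 fg0 => y /= fgy.
  by rewrite -fgx /= !fctE /= fgy.
have cdf := diff_continuous df.
by apply/diff_locallyP; rewrite (diff_unique cdf key).
Qed.

Section MatrixCalculus.
Context {R : realType} {V : normedModType R}.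

Lemma differentiable_entry m n (M : V -> 'M[R]_(m, n)) (x : V) i j :
  differentiable M x -> differentiable (fun y => M y i j) x.
Proof.
move=> dM; apply: (@differentiable_comp _ _ _ _ M (fun N : 'M[R]_(m, n) => N i j)) => //.
exact: differentiable_coord.
Qed.

Lemma differentiable_mx m n (M : V -> 'M[R]_(m, n)) (x : V) :
  (forall i j, differentiable (fun y => M y i j) x) -> differentiable M x.
Proof.
move=> dM.
have -> : M = \sum_i \sum_j (fun y => M y i j *: delta_mx i j).
  apply/funext => y; rewrite {1}(matrix_sum_delta (M y)) fct_sumE.
  by apply: eq_bigr => i _; rewrite fct_sumE.
apply: differentiable_sum => i; apply: differentiable_sum => j.
exact: differentiableZl.
Qed.

Lemma derive_entry m n (M : V -> 'M[R]_(m, n)) (x v : V) i j :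
  differentiable M x -> ('D_v M x) i j = 'D_v (fun y => M y i j) x.
Proof. by move=> dM; rewrite derive_mx ?mxE//; exact: diff_derivable. Qed.

Lemma differentiable_sumr I (s : seq I) (P : pred I) (W : normedModType R)
    (f : I -> V -> W) (x : V) :
  (forall i, P i -> differentiable (f i) x) ->
  differentiable (fun y => \sum_(i <- s | P i) f i y) x.
Proof.
move=> df; elim: s => [|i s IH].
  under eq_fun do rewrite big_nil.
  exact: differentiable_cst.
under eq_fun do rewrite big_cons.
by case Pi: (P i) => //; apply: differentiableD => //; exact: df.
Qed.

Lemma differentiable_prodr I (s : seq I) (P : pred I) (f : I -> V -> R) (x : V) :
  (forall i, P i -> differentiable (f i) x) ->
  differentiable (fun y => \prod_(i <- s | P i) f i y) x.
Proof.
move=> df; elim: s => [|i s IH].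
  under eq_fun do rewrite big_nil.
  exact: differentiable_cst.
under eq_fun do rewrite big_cons.
by case Pi: (P i) => //; apply: differentiableM => //; exact: df.
Qed.

Lemma derive_sumr n (W : normedModType R)
    (f : 'I_n -> V -> W) (x v : V) :
  (forall i, differentiable (f i) x) ->
  'D_v (fun y => \sum_i f i y) x = \sum_i 'D_v (f i) x.
Proof.
move=> df; have -> : (fun y => \sum_i f i y) = \sum_i f i.
  by apply/funext => y; rewrite fct_sumE.
by rewrite derive_sum// => i; exact: diff_derivable.
Qed.

Lemma differentiable_mulmx m n p (M : V -> 'M[R]_(m, n)) (N : V -> 'M[R]_(n, p)) x :
  differentiable M x -> differentiable N x ->
  differentiable (fun y => M y *m N y) x.
Proof.
move=> dM dN; apply: differentiable_mx => i j.
under eq_fun do rewrite mxE.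
by apply: differentiable_sumr => k _; apply: differentiableM;
  exact: differentiable_entry.
Qed.

Lemma derive_mulmx m n p (M : V -> 'M[R]_(m, n)) (N : V -> 'M[R]_(n, p)) x v :
  differentiable M x -> differentiable N x ->
  'D_v (fun y => M y *m N y) x = 'D_v M x *m N x + M x *m 'D_v N x.
Proof.
move=> dM dN; apply/matrixP => i j.
rewrite derive_entry; last exact: differentiable_mulmx.
rewrite (_ : (fun y => _) = (fun y => \sum_k M y i k * N y k j)); last first.
  by apply/funext => y; rewrite mxE.
rewrite derive_sumr; last first.
  by move=> k; apply: differentiableM; exact: differentiable_entry.
rewrite !mxE -big_split /=; apply: eq_bigr => k _.
rewrite deriveM; try by apply: diff_derivable; exact: differentiable_entry.
rewrite (derive_entry _ _ _ dM) (derive_entry _ _ _ dN) addrC; congr (_ + _).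
by rewrite /GRing.scale/= mulrC.
Qed.

Lemma differentiable_trmx m n (M : V -> 'M[R]_(m, n)) x :
  differentiable M x -> differentiable (fun y => (M y)^T) x.
Proof.
move=> dM; apply: differentiable_mx => i j.
by under eq_fun do rewrite mxE; exact: differentiable_entry.
Qed.

Lemma derive_trmx m n (M : V -> 'M[R]_(m, n)) x v :
  differentiable M x -> 'D_v (fun y => (M y)^T) x = ('D_v M x)^T.
Proof.
move=> dM; apply/matrixP => i j; rewrite derive_entry; last exact: differentiable_trmx.
rewrite (_ : (fun y => _) = (fun y => M y j i)) ?mxE ?derive_entry//.
by apply/funext => y; rewrite mxE.
Qed.

Lemma differentiable_det n (M : V -> 'M[R]_n) x :
  differentiable M x -> differentiable (fun y => \det (M y)) x.
Proof.
move=> dM; apply: differentiable_sumr => s _.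
apply: differentiableM; first exact: differentiable_cst.
by apply: differentiable_prodr => i _; exact: differentiable_entry.
Qed.

(** By Cramer's rule the inverse agrees near x with the adjugate divided by the
    determinant, and both are polynomials in the entries. *)
Lemma differentiable_invmx n (M : V -> 'M[R]_n) x :
  (\forall y \near x, M y \in unitmx) ->
  differentiable M x -> differentiable (fun y => invmx (M y)) x.
Proof.
move=> uM dM.
apply: (@near_eq_differentiable _ _ _ (fun y => (\det (M y))^-1 *: \adj (M y))).
  by apply: filterS uM => y uMy; rewrite /invmx uMy.
apply: differentiable_mx => i j.
under eq_fun do rewrite !mxE /cofactor.
apply: differentiableM.
  apply: differentiableV; first exact: differentiable_det.
  by rewrite -unitfE -unitmxE; exact: nbhs_singleton uM.
apply: differentiableM; first exact: differentiable_cst.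
apply: differentiable_det; apply: differentiable_mx => k l.
by under eq_fun do rewrite !mxE; exact: differentiable_entry.
Qed.

End MatrixCalculus.

(** * The chain rule *)

Section ChainRule.
Context {R : realType}.

Lemma derive_comp (U V W : normedModType R) (f : U -> V) (g : V -> W) (x v : U) :
  differentiable f x -> differentiable g (f x) ->
  'D_v (fun y => g (f y)) x = 'D_('D_v f x) g (f x).
Proof.
move=> df dg.
have dgf : differentiable (g \o f) x by exact: differentiable_comp.
by rewrite -[LHS]/('D_v (g \o f) x) deriveE// diff_comp//= -!deriveE.
Qed.

Lemma derive_partial m (W : normedModType R) (f : 'rV[R]_m -> W) x a :
  differentiable f x -> 'D_a f x = \sum_i a 0 i *: partial i f x.
Proof.
move=> df; rewrite deriveE// {1}(row_sum_delta a) linear_sum /=.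
by apply: eq_bigr => i _; rewrite linearZ /= /partial deriveE.
Qed.

Lemma deriveDr (U W : normedModType R) (f : U -> W) x a b :
  differentiable f x -> 'D_(a + b) f x = 'D_a f x + 'D_b f x.
Proof. by move=> df; rewrite !deriveE// linearD. Qed.

Lemma deriveZr (U W : normedModType R) (f : U -> W) x c a :
  differentiable f x -> 'D_(c *: a) f x = c *: 'D_a f x.
Proof. by move=> df; rewrite !deriveE// linearZ. Qed.

(* restriction to the line through x in the direction v *)
(** The derivative of f along v is an ordinary derivative of a function of one
    real variable; this is what gives access to the mean value theorem. *)
Lemma is_derive_line (U W : normedModType R) (f : U -> W) (x v : U) (s : R) :
  differentiable f (x + s *: v) ->
  is_derive s 1 (fun t : R => f (x + t *: v)) ('D_v f (x + s *: v)).
Proof.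
move=> df.
have dl : is_diff s (fun t : R => x + t *: v) ( *:%R ^~ v).
  have := is_diffD (is_diff_cst x s) (is_diff_scalel s v).
  by rewrite add0r.
have dfl : differentiable (f \o (fun t : R => x + t *: v)) s.
  exact: differentiable_comp.
apply: DeriveDef; first exact: diff_derivable.
rewrite (@derive_comp _ _ _ _ f s 1 (ex_diff (is_diff_def := dl)) df).
by rewrite (deriveE _ (ex_diff (is_diff_def := dl))) diff_val scale1r.
Qed.

End ChainRule.

(** * Symmetry of second derivatives *)

Section Schwarz.
Context {R : realType} {U : normedModType R}.
Implicit Types (x a b : U) (s : R).

Lemma MVT_line (f : U -> R) x v s : 0 < s ->
  (forall t : R, t \in `[0, s] -> differentiable f (x + t *: v)) ->
  exists2 t : R, t \in `[0, s] & f (x + s *: v) - f x = 'D_v f (x + t *: v) * s.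
Proof.
move=> s0 df.
have dl (t : R) : t \in `[0, s] ->
    is_derive t 1 (fun t : R => f (x + t *: v)) ('D_v f (x + t *: v)).
  by move=> ts; apply: is_derive_line; exact: df.
have [t ts] := MVT s0 (fun t ts => dl t (subset_itv_oo_cc ts))
  (derivable_within_continuous (fun t ts => @ex_derive _ _ _ _ _ _ _ (dl t ts))).
rewrite scale0r addr0 subr0 => ->; exists t => //.
exact: subset_itv_oo_cc.
Qed.

(** The mean value theorem is used twice: for the difference of f on the two
    sides parallel to a, then for the derivative along a on a segment parallel
    to b. The left-hand side is symmetric in a and b, which is the source of the
    symmetry of second derivatives. *)
Lemma second_difference (f : U -> R) x a b s : 0 < s ->
  (forall t u : R, t \in `[0, s] -> u \in `[0, s] ->
     differentiable f (x + t *: a + u *: b) /\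
     differentiable ('D_a f) (x + t *: a + u *: b)) ->
  exists t u : R, [/\ t \in `[0, s], u \in `[0, s] &
    f (x + s *: a + s *: b) - f (x + s *: a) - f (x + s *: b) + f x
    = 'D_b ('D_a f) (x + t *: a + u *: b) * s ^+ 2].
Proof.
move=> s0 df.
have s_s : s \in `[0, s] by rewrite in_itv /= lexx (ltW s0).
have s_0 : (0 : R) \in `[0, s] by rewrite in_itv /= lexx (ltW s0).
have df1 (t u : R) : t \in `[0, s] -> u \in `[0, s] ->
    differentiable f (x + t *: a + u *: b).
  by move=> ts us; have [] := df t u ts us.
have dp (u t : R) : u \in `[0, s] -> t \in `[0, s] ->
    is_derive t 1 (fun t : R => f ((x + u *: b) + t *: a))
                  ('D_a f ((x + u *: b) + t *: a)).
  by move=> us ts; apply: is_derive_line; rewrite addrAC; exact: df1.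
pose phi := (fun t : R => f ((x + s *: b) + t *: a))
            - (fun t : R => f ((x + 0 *: b) + t *: a)).
have dphi (t : R) : t \in `[0, s] -> is_derive t 1 phi
    ('D_a f ((x + s *: b) + t *: a) - 'D_a f ((x + 0 *: b) + t *: a)).
  by move=> ts; apply: is_deriveB; exact: dp.
have [t ts phiE] := MVT s0 (fun t ts => dphi t (subset_itv_oo_cc ts))
  (derivable_within_continuous (fun t ts => @ex_derive _ _ _ _ _ _ _ (dphi t ts))).
have ts' : t \in `[0, s] by exact: subset_itv_oo_cc.
have [|u us uE] := @MVT_line ('D_a f) (x + t *: a) b s s0.
  by move=> u us; have [] := df t u ts' us.
exists t, u; split => //.
transitivity (phi s - phi 0).
  rewrite /phi !fctE !scale0r !addr0 [x + s *: b + _]addrAC.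
  ring.
rewrite phiE subr0 scale0r addr0 [x + s *: b + _]addrAC uE.
by rewrite expr2 mulrA.
Qed.

Lemma near_two_continuous (A : set U) (g1 g2 : U -> R) x (e : R) :
  open A -> A x -> {for x, continuous g1} -> {for x, continuous g2} -> 0 < e ->
  exists2 r : R, 0 < r & forall y, ball x r y ->
    [/\ A y, `|g1 x - g1 y| < e & `|g2 x - g2 y| < e].
Proof.
move=> oA Ax c1 c2 e0.
have nA : nbhs x A by exact: open_nbhs_nbhs.
have n1 : nbhs x (fun y => `|g1 x - g1 y| < e).
  by move/cvgrPdist_lt : c1 => /(_ _ e0).
have n2 : nbhs x (fun y => `|g2 x - g2 y| < e).
  by move/cvgrPdist_lt : c2 => /(_ _ e0).
have [r /= r0 rA] := (nbhs_ballP _ _).1 (filterI nA (filterI n1 n2)).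
by exists r => // y /rA[? []].
Qed.

(** Both mixed derivatives, taken at suitable points of a small parallelogram
    with corner x, are equal to the same second difference divided by the square
    of the side; continuity at x then identifies their values at x. *)
Lemma schwarz_scalar (f : U -> R) (A : set U) x a b : open A -> A x ->
  (forall y, A y -> [/\ differentiable f y, differentiable ('D_a f) y
                       & differentiable ('D_b f) y]) ->
  {for x, continuous ('D_b ('D_a f))} -> {for x, continuous ('D_a ('D_b f))} ->
  'D_b ('D_a f) x = 'D_a ('D_b f) x.
Proof.
move=> oA Ax df cba cab.
apply/eqP; rewrite -subr_eq0 -normr_le0; apply/ler_addgt0Pl => /= e e0; rewrite addr0.
have e20 : 0 < e / 2 by rewrite divr_gt0.
have [r r0 rA] := near_two_continuous oA Ax cba cab e20.
(* This side keeps the whole parallelogram in the ball of radius r; the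
   summand 1 avoids a division by zero. *)
pose s := r / (`|a| + `|b| + 1).
have ab0 : 0 < `|a| + `|b| + 1 by rewrite ltr_wpDl// addr_ge0.
have s0 : 0 < s by rewrite divr_gt0.
have inr (t u : R) : t \in `[0, s] -> u \in `[0, s] -> ball x r (x + t *: a + u *: b).
  rewrite !in_itv /= => /andP[t0 ts] /andP[u0 us].
  rewrite -ball_normE /ball_ /= opprD addrA opprD addrA subrr sub0r -opprD normrN.
  apply: (le_lt_trans (ler_normD _ _)); rewrite !normrZ !ger0_norm//.
  apply: (@le_lt_trans _ _ (s * (`|a| + `|b|))).
    by rewrite mulrDr lerD// ler_wpM2r.
  by rewrite /s -mulrA gtr_pMr// mulrC ltr_pdivrMr// mul1r ltrDl.
have [|t1 [u1 [t1s u1s E1]]] := @second_difference f x a b s s0.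
  by move=> t u ts us; have [/df[]] := rA _ (inr _ _ ts us).
have [|t2 [u2 [t2s u2s E2]]] := @second_difference f x b a s s0.
  by move=> t u ts us; rewrite addrAC; have [/df[]] := rA _ (inr _ _ us ts).
have comm : x + s *: a + s *: b = x + s *: b + s *: a by rewrite addrAC.
have EE : 'D_b ('D_a f) (x + t1 *: a + u1 *: b)
        = 'D_a ('D_b f) (x + t2 *: b + u2 *: a).
  apply: (@mulIf _ (s ^+ 2)); first by rewrite expf_neq0// gt_eqF.
  apply: etrans (esym E1) _; apply: etrans _ E2.
  by congr (_ + _); rewrite comm addrAC.
have [_ h1 _] := rA _ (inr _ _ t1s u1s).
have [_ _] := rA _ (inr _ _ u2s t2s); rewrite addrAC -EE => h2.
rewrite -(subrKA ('D_b ('D_a f) (x + t1 *: a + u1 *: b))).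
apply: (le_trans (ler_normD _ _)); rewrite [leRHS](splitr e).
rewrite distrC in h2; exact: lerD (ltW h1) (ltW h2).
Qed.

End Schwarz.

(** * Smooth functions in coordinates *)

Section SmoothFunctions.
Context {R : realType} {m : nat}.
Implicit Types (A B : set 'rV[R]_m).

Lemma near_open A (P : set 'rV[R]_m) x :
  open A -> A x -> (forall y, A y -> P y) -> \forall y \near x, P y.
Proof. by move=> oA Ax AP; apply: filterS AP _; exact: open_nbhs_nbhs. Qed.

Lemma eq_partial A (W : normedModType R) k (f g : 'rV[R]_m -> W) x :
  open A -> A x -> (forall y, A y -> f y = g y) -> partial k f x = partial k g x.
Proof. by move=> oA Ax fg; apply: near_eq_derive; exact: near_open fg. Qed.

Lemma eq_differentiable A (W : normedModType R) (f g : 'rV[R]_m -> W) x :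
  open A -> A x -> (forall y, A y -> f y = g y) ->
  differentiable f x -> differentiable g x.
Proof. by move=> oA Ax fg; apply: near_eq_differentiable; exact: near_open fg. Qed.

Lemma CrW (W : normedModType R) r A (f : 'rV[R]_m -> W) : Cr r.+1 A f -> Cr r A f.
Proof.
elim: r f => [|r IH] f [df dp].
  by move=> x Ax; apply: differentiable_continuous; exact: df.
by split => // k; apply: IH; exact: dp.
Qed.

Lemma eq_Cr (W : normedModType R) r A (f g : 'rV[R]_m -> W) : open A ->
  (forall x, A x -> f x = g x) -> Cr r A f -> Cr r A g.
Proof.
move=> oA; elim: r f g => [|r IH] f g fg.
  move=> cf x Ax; rewrite /prop_for /continuous_at -(fg x Ax).
  have nfg : \forall y \near nbhs x, f y = g y by exact: near_open fg.
  exact: (cvg_trans (near_eq_cvg nfg) (cf x Ax)).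
move=> [df dp]; split => [x Ax|k]; first exact: eq_differentiable fg (df x Ax).
by apply: IH (dp k) => x Ax; exact: eq_partial fg.
Qed.

Lemma subset_Cr (W : normedModType R) r A B (f : 'rV[R]_m -> W) :
  B `<=` A -> Cr r A f -> Cr r B f.
Proof.
move=> BA; elim: r f => [|r IH] f; first by move=> cf x /BA; exact: cf.
by move=> [df dp]; split => [x /BA|k]; [exact: df|apply: IH; exact: dp].
Qed.

Lemma subset_smooth (W : normedModType R) A B (f : 'rV[R]_m -> W) :
  B `<=` A -> smooth A f -> smooth B f.
Proof. by move=> BA sf r; apply: subset_Cr (sf r). Qed.

Lemma smooth_differentiable (W : normedModType R) A (f : 'rV[R]_m -> W) x :
  smooth A f -> A x -> differentiable f x.
Proof. by move=> sf Ax; have [df _] := sf 1; exact: df. Qed.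

Lemma smooth_continuous (W : normedModType R) A (f : 'rV[R]_m -> W) x :
  smooth A f -> A x -> {for x, continuous f}.
Proof. by move=> sf Ax; exact: (sf 0). Qed.

Lemma smooth_partial (W : normedModType R) A (f : 'rV[R]_m -> W) k :
  smooth A f -> smooth A (partial k f).
Proof. by move=> sf r; have [_] := sf r.+1; exact. Qed.

(** Gives the smoothness of a function that is only known through its gradient,
    such as the angle of a parallel normal field. *)
Lemma smooth_of_partial (W : normedModType R) A (f : 'rV[R]_m -> W) :
  (forall x, A x -> differentiable f x) -> (forall k, smooth A (partial k f)) ->
  smooth A f.
Proof.
move=> df sp [|r]; last by split => // k; exact: sp.
by move=> x Ax; apply: differentiable_continuous; exact: df.
Qed.

Lemma Cr_partial (W : normedModType R) r A (f : 'rV[R]_m -> W) k :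
  Cr r.+1 A f -> Cr r A (partial k f).
Proof. by move=> [_]; exact. Qed.

(** One order is given up so that continuity of an entry, the base case, can be
    read off from differentiability of the matrix; nothing is lost for smooth
    functions. *)
Lemma Cr_entry p q r A (f : 'rV[R]_m -> 'M[R]_(p, q)) i j : open A ->
  Cr r.+1 A f -> Cr r A (fun x => f x i j).
Proof.
move=> oA; elim: r f => [|r IH] f [df dp].
  move=> x Ax; apply: differentiable_continuous.
  by apply: differentiable_entry; exact: df.
split=> [x Ax|k]; first by apply: differentiable_entry; exact: df.
apply: eq_Cr (IH _ (dp k)) => // x Ax.
by rewrite /partial derive_entry//; exact: df.
Qed.

Lemma Cr_mx p q r A (f : 'rV[R]_m -> 'M[R]_(p, q)) : open A ->
  (forall i j, Cr r.+1 A (fun x => f x i j)) -> Cr r A f.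
Proof.
move=> oA; elim: r f => [|r IH] f sf.
  move=> x Ax; apply: differentiable_continuous; apply: differentiable_mx => i j.
  by have [df _] := sf i j; exact: df.
have df x : A x -> differentiable f x.
  by move=> Ax; apply: differentiable_mx => i j; have [df _] := sf i j; exact: df.
split=> // k; apply: IH => i j.
apply: eq_Cr (Cr_partial k (sf i j)) => // x Ax.
by rewrite /partial derive_entry//; exact: df.
Qed.

Lemma smooth_entry p q A (f : 'rV[R]_m -> 'M[R]_(p, q)) i j : open A ->
  smooth A f -> smooth A (fun x => f x i j).
Proof. by move=> oA sf r; apply: Cr_entry; last exact: sf. Qed.

Lemma smooth_mx p q A (f : 'rV[R]_m -> 'M[R]_(p, q)) : open A ->
  (forall i j, smooth A (fun x => f x i j)) -> smooth A f.
Proof. by move=> oA sf r; apply: Cr_mx => // i j; exact: sf. Qed.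

Lemma Cr_add (W : normedModType R) r A (f g : 'rV[R]_m -> W) : open A ->
  Cr r A f -> Cr r A g -> Cr r A (fun x => f x + g x).
Proof.
move=> oA; elim: r f g => [|r IH] f g.
  by move=> cf cg x Ax; exact: cvgD (cf x Ax) (cg x Ax).
move=> [df pf] [dg pg]; split => [x Ax|k].
  by apply: differentiableD; [exact: df|exact: dg].
apply: eq_Cr (IH _ _ (pf k) (pg k)) => // x Ax.
by rewrite /partial deriveD//; apply: diff_derivable; [exact: df|exact: dg].
Qed.

Lemma Cr_mul r A (f g : 'rV[R]_m -> R) : open A ->
  Cr r A f -> Cr r A g -> Cr r A (fun x => f x * g x).
Proof.
move=> oA; elim: r f g => [|r IH] f g.
  by move=> cf cg x Ax; exact: cvgM (cf x Ax) (cg x Ax).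
move=> Cf Cg; have [df pf] := Cf; have [dg pg] := Cg; split => [x Ax|k].
  by apply: differentiableM; [exact: df|exact: dg].
have := Cr_add oA (IH _ _ (CrW Cf) (pg k)) (IH _ _ (CrW Cg) (pf k)).
apply: eq_Cr => // x Ax; rewrite /partial [RHS]deriveM//.
  by apply: diff_derivable; exact: df.
by apply: diff_derivable; exact: dg.
Qed.

Lemma Cr_cst (W : normedModType R) r A (c : W) : Cr r A (cst c).
Proof.
elim: r c => [|r IH] c; first by move=> x _; apply: cst_continuous.
split=> [x _|k]; first exact: differentiable_cst.
rewrite (_ : partial k (cst c) = cst 0)//.
by apply/funext => x; rewrite /partial derive_cst.
Qed.

Lemma smooth_add (W : normedModType R) A (f g : 'rV[R]_m -> W) : open A ->
  smooth A f -> smooth A g -> smooth A (fun x => f x + g x).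
Proof. by move=> oA sf sg r; exact: Cr_add. Qed.

Lemma smooth_mul A (f g : 'rV[R]_m -> R) : open A ->
  smooth A f -> smooth A g -> smooth A (fun x => f x * g x).
Proof. by move=> oA sf sg r; exact: Cr_mul. Qed.

Lemma smooth_cst (W : normedModType R) A (c : W) : smooth A (fun=> c).
Proof. by move=> r; exact: Cr_cst. Qed.

Lemma smooth_scale p q A (f : 'rV[R]_m -> R) (g : 'rV[R]_m -> 'M[R]_(p, q)) :
  open A -> smooth A f -> smooth A g -> smooth A (fun x => f x *: g x).
Proof.
move=> oA sf sg; apply: smooth_mx => // i j.
under eq_fun do rewrite mxE.
by apply: smooth_mul => //; exact: smooth_entry.
Qed.

Lemma differentiable_expR (f : 'rV[R]_m -> R) x :
  differentiable f x -> differentiable (fun y => expR (f y)) x.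
Proof.
move=> df; apply: (@differentiable_comp _ _ _ _ f expR) => //.
by apply/derivable1_diffP; exact: derivable_expR.
Qed.

Lemma derive_real_comp (g : R -> R) (f : 'rV[R]_m -> R) x v dg :
  differentiable f x -> is_derive (f x) 1 g dg ->
  'D_v (fun y => g (f y)) x = 'D_v f x * dg.
Proof.
move=> df Dg.
have dg' : differentiable g (f x) by apply/derivable1_diffP; exact: ex_derive.
rewrite (derive_comp _ df dg') -[X in 'D_X g _]mulr1.
by rewrite -[_ * 1]/(_ *: (1 : R)) deriveZr// derive_val.
Qed.

Lemma partial_expR (f : 'rV[R]_m -> R) x k :
  differentiable f x -> partial k (fun y => expR (f y)) x = partial k f x * expR (f x).
Proof. by move=> df; rewrite /partial (derive_real_comp _ df (is_derive_expR _)). Qed.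

Lemma smooth_expR A (f : 'rV[R]_m -> R) : open A ->
  smooth A f -> smooth A (fun x => expR (f x)).
Proof.
move=> oA sf; elim => [|r IH].
  by move=> x Ax; apply: differentiable_continuous; apply: differentiable_expR;
    exact: smooth_differentiable Ax.
split=> [x Ax|k].
  by apply: differentiable_expR; exact: smooth_differentiable Ax.
apply: eq_Cr (Cr_mul oA (smooth_partial k sf r) IH) => // x Ax.
by rewrite partial_expR//; exact: smooth_differentiable Ax.
Qed.

Lemma schwarz p q A (f : 'rV[R]_m -> 'M[R]_(p, q)) x i j : open A -> A x ->
  smooth A f -> partial i (partial j f) x = partial j (partial i f) x.
Proof.
move=> oA Ax sf; apply/matrixP => k l.
pose g : 'rV[R]_m -> R := fun y => f y k l.
have pg a y : A y -> (partial a f y) k l = partial a g y.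
  by move=> Ay; rewrite /partial derive_entry//; exact: smooth_differentiable Ay.
have ppg a b : (partial a (partial b f) x) k l = partial a (partial b g) x.
  have dpf := smooth_differentiable (smooth_partial b sf) Ax.
  rewrite {1}/partial (derive_entry _ _ _ dpf).
  exact: (eq_partial _ oA Ax (pg b)).
have sg : smooth A g by exact: smooth_entry.
have dg y : A y -> [/\ differentiable g y, differentiable (partial j g) y
                     & differentiable (partial i g) y].
  by move=> Ay; split; [exact: smooth_differentiable sg Ay
    |exact: smooth_differentiable (smooth_partial j sg) Ay
    |exact: smooth_differentiable (smooth_partial i sg) Ay].
have cij := smooth_continuous (smooth_partial i (smooth_partial j sg)) Ax.
have cji := smooth_continuous (smooth_partial j (smooth_partial i sg)) Ax.
apply: etrans (ppg i j) (etrans _ (esym (ppg j i))).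
exact: (@schwarz_scalar R _ g A x (delta_mx 0 j) (delta_mx 0 i) oA Ax dg cij cji).
Qed.

End SmoothFunctions.

(** * Functions with zero gradient *)

Section ConstantOnConnected.
Context {R : realType} {m : nat}.

Lemma constant_on_ball (f : 'rV[R]_m -> R) (V : set 'rV[R]_m) x (r : R) :
  (forall y, V y -> differentiable f y) ->
  (forall y k, V y -> partial k f y = 0) ->
  ball x r `<=` V -> forall y, ball x r y -> f y = f x.
Proof.
move=> df pf rV y xy.
have seg (t : R) : t \in `[0, 1] -> ball x r (x + t *: (y - x)).
  rewrite in_itv /= => /andP[t0 t1]; move: xy.
  rewrite -!ball_normE /ball_ /= opprD addrA subrr sub0r normrN normrZ ger0_norm//.
  rewrite (distrC x y); apply: le_lt_trans.
  by rewrite ler_piMl.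
have [t ts] := MVT_line (ltr01 : 0 < (1 : R)) (fun t ts => df _ (rV _ (seg t ts))).
rewrite scale1r subrKC mulr1 => E; apply/eqP; rewrite -subr_eq0 E.
rewrite derive_partial; last exact: df _ (rV _ (seg t ts)).
by rewrite big1// => k _; rewrite pf ?scaler0//; exact: rV _ (seg t ts).
Qed.

(** A level set is open because f is constant on balls, and its complement is
    open for the same reason; connectedness leaves a single level set. *)
Lemma constant_of_partial0 (f : 'rV[R]_m -> R) (V : set 'rV[R]_m) :
  open V -> connected V ->
  (forall y, V y -> differentiable f y) ->
  (forall y k, V y -> partial k f y = 0) ->
  forall x y, V x -> V y -> f y = f x.
Proof.
move=> oV cV df pf x y Vx Vy.
(* Used for the level of x and for its complement. *)
have open_level (P : set R) : open [set z | V z /\ P (f z)].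
  rewrite openE => z [Vz Pz].
  have [r /= r0 rV] := (nbhs_ballP _ _).1 (open_nbhs_nbhs (conj oV Vz)).
  apply/nbhs_ballP; exists r => //= w zw.
  by split; [exact: rV|rewrite (constant_on_ball df pf rV zw)].
have BV : V `&` [set z | f z = f x] = V.
  apply: cV.
  - by exists x.
  - exists [set z | V z /\ f z = f x]; first exact: (open_level [set c | c = f x]).
    by apply/seteqP; split => z /= [Vz] => [fz|[_ fz]].
  - exists (~` [set z | V z /\ f z <> f x]).
      by apply: open_closedC; exact: (open_level [set c | c <> f x]).
    apply/seteqP; split => z /= [Vz] => [fz|nfz]; first by split => // -[].
    by split => //; apply: contrapT => fz; apply: nfz.
by have : V y by []; rewrite -{1}BV => -[].
Qed.

End ConstantOnConnected.

(** * The Levi-Civita connection in a chart *)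

(** B and C stand for the connection matrices A_i and A_j, P and Q for d_i A_j
    and d_j A_i, and g for the metric. The hypothesis is the equality of the two
    mixed second derivatives of g, after the first derivatives have been
    expressed through metric compatibility. *)
Lemma skew_of_second_derivatives (R : realFieldType) n (P Q g B C : 'M[R]_n) :
  P *m g + C *m (B *m g + g *m B^T) + ((B *m g + g *m B^T) *m C^T + g *m P^T)
  = Q *m g + B *m (C *m g + g *m C^T) + ((C *m g + g *m C^T) *m B^T + g *m Q^T) ->
  (P - Q + (C *m B - B *m C)) *m g + g *m (P - Q + (C *m B - B *m C))^T = 0.
Proof.
have -> : (P - Q + (C *m B - B *m C))^T
    = P^T - Q^T + (B^T *m C^T - C^T *m B^T).
  rewrite -!trmx_mul; set X := C *m B; set Y := B *m C.
  by apply/matrixP => p q; rewrite !mxE.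
rewrite !mulmxDl !mulmxDr !mulmxN !mulNmx !mulmxA => H.
apply/matrixP => p q; move/matrixP/(_ p q): H.
set P1 := P *m g; set P2 := g *m P^T; set Q1 := Q *m g; set Q2 := g *m Q^T.
set X1 := C *m B *m g; set X2 := B *m C *m g.
set Y1 := g *m B^T *m C^T; set Y2 := g *m C^T *m B^T.
set Z1 := C *m g *m B^T; set Z2 := B *m g *m C^T.
by rewrite !mxE => H; lra.
Qed.

Section LeviCivita.
Context {R : realType} {n : nat}.
Variables (W : set 'rV[R]_n) (G : 'rV[R]_n -> 'M[R]_n).
Hypotheses (W_open : open W) (G_smooth : smooth W G).
Hypotheses (G_sym : forall x, W x -> (G x)^T = G x).
Hypothesis G_unit : forall x, W x -> G x \in unitmx.
Implicit Types (x a b c d : 'rV[R]_n) (i j k l : 'I_n).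

(** Vectors are rows, so the covariant derivative in the i-th direction is X |->
    d_i X + X *m A_i: the Christoffel symbol with upper index l and lower
    indices i, k is the entry of index (k, l). *)
Definition connection_matrix i x : 'M[R]_n := \matrix_(k, l) christoffel G x l i k.

Local Notation A := connection_matrix.

Definition connection_along x a : 'M[R]_n := \sum_i a 0 i *: A i x.

(** The operator R(d_i, d_j) acting on rows from the right, whence the order of
    the two products. *)
Definition curvature_matrix x i j : 'M[R]_n :=
  partial i (A j) x - partial j (A i) x + (A j x *m A i x - A i x *m A j x).

Definition curvature_operator x a b : 'M[R]_n :=
  \sum_i \sum_j (a 0 i * b 0 j) *: curvature_matrix x i j.

Lemma differentiable_metric x : W x -> differentiable G x.
Proof. by move=> Wx; exact: smooth_differentiable Wx. Qed.

Lemma partial_metric_sym x k i j : W x ->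
  partial k (fun y => G y i j) x = partial k (fun y => G y j i) x.
Proof. by move=> Wx; apply: (eq_partial _ W_open Wx) => y Wy; rewrite -{1}G_sym// mxE. Qed.

Lemma differentiable_connection i x : W x -> differentiable (A i) x.
Proof.
move=> Wx; apply: differentiable_mx => k l.
under eq_fun do rewrite mxE /christoffel.
have dp (p q r : 'I_n) : differentiable (fun y => partial p (fun z => G z q r) y) x.
  by apply: smooth_differentiable Wx; apply: smooth_partial; exact: smooth_entry.
apply: differentiableM; first exact: differentiable_cst.
apply: differentiable_sumr => q _.
apply: differentiableM.
  apply: differentiable_entry; apply: differentiable_invmx.
    exact: near_open G_unit.
  exact: differentiable_metric.
by apply: differentiableB; [apply: differentiableD|]; exact: dp.
Qed.

Lemma christoffel_sym x l i j : W x -> christoffel G x l i j = christoffel G x l j i.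
Proof.
move=> Wx; congr (_ * _); apply: eq_bigr => k _; congr (_ * _).
by rewrite [X in X - _]addrC (partial_metric_sym k i j).
Qed.

(** Koszul's formula: lowering the upper index of the Christoffel symbols
    cancels the inverse metric in their definition. *)
Lemma connection_metric i x : W x ->
  A i x *m G x = \matrix_(j, k) (2^-1 *
    (partial i (fun y => G y j k) x + partial j (fun y => G y i k) x
     - partial k (fun y => G y i j) x)).
Proof.
move=> Wx; rewrite -[RHS](mulmxKV (G_unit Wx)); congr (_ *m _).
have invG_sym : (invmx (G x))^T = invmx (G x) by rewrite trmx_inv G_sym.
apply/matrixP => j l; rewrite !mxE /christoffel mulr_sumr.
by apply: eq_bigr => k _; rewrite !mxE -{1}invG_sym mxE; ring.
Qed.

(** Metric compatibility: symmetrizing Koszul's formula leaves only the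
    derivative of the metric in the i-th direction. *)
Lemma partial_metric i x : W x ->
  partial i G x = A i x *m G x + G x *m (A i x)^T.
Proof.
move=> Wx; have -> : G x *m (A i x)^T = (A i x *m G x)^T.
  by rewrite trmx_mul G_sym.
rewrite connection_metric//; apply/matrixP => j k; rewrite !mxE.
rewrite /partial (derive_entry _ _ _ (differentiable_metric Wx)).
have E (p q r : 'I_n) : 'D_(delta_mx 0 p) (fun y => G y q r) x =
  partial p (fun y => G y q r) x by [].
rewrite !E (partial_metric_sym i k j)//.
by field.
Qed.

(** Metric compatibility is differentiated once more; the mixed second
    derivatives of the metric agree, and what is left of their difference is the
    symmetric part of the lowered curvature. *)
Lemma curvature_matrix_skew x i j : W x ->
  curvature_matrix x i j *m G x + G x *m (curvature_matrix x i j)^T = 0.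
Proof.
move=> Wx.
have second k l : partial k (partial l G) x =
    partial k (A l) x *m G x + A l x *m partial k G x
    + (partial k G x *m (A l x)^T + G x *m (partial k (A l) x)^T).
  have dG := differentiable_metric Wx.
  have dA := differentiable_connection l Wx.
  rewrite (eq_partial _ W_open Wx (partial_metric l)) /partial deriveD.
  - rewrite derive_mulmx// derive_mulmx ?derive_trmx//.
    exact: differentiable_trmx.
  - by apply: diff_derivable; exact: differentiable_mulmx.
  - apply: diff_derivable; apply: differentiable_mulmx => //.
    exact: differentiable_trmx.
have H := etrans (esym (second i j)) (etrans (schwarz i j W_open Wx G_smooth) (second j i)).
rewrite (partial_metric i Wx) (partial_metric j Wx) in H.
exact: skew_of_second_derivatives H.
Qed.

Lemma riemannE x l i j k : W x -> riemann G x l i j k = curvature_matrix x i j k l.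
Proof.
move=> Wx.
have E p q : partial p (fun y => christoffel G y l q k) x = (partial p (A q) x) k l.
  rewrite /partial (derive_entry _ _ _ (differentiable_connection q Wx)).
  by congr ('D__ _ _); apply/funext => y; rewrite mxE.
rewrite /riemann (E i j) (E j i) /curvature_matrix.
set P := partial i (A j) x; set Q := partial j (A i) x.
rewrite !mxE -sumrB; congr (_ + _); apply: eq_bigr => m _.
by rewrite !mxE; ring.
Qed.

Lemma christoffel_formE x a b : christoffel_form G x a b = b *m connection_along x a.
Proof.
apply/rowP => l; rewrite !mxE exchange_big /=; apply: eq_bigr => j _.
rewrite /connection_along summxE mulr_sumr; apply: eq_bigr => i _.
by rewrite !mxE; ring.
Qed.

Lemma curvatureE x a b c : W x -> curvature G x a b c = c *m curvature_operator x a b.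
Proof.
move=> Wx; apply/rowP => l; rewrite !mxE.
have -> : \sum_j c 0 j * curvature_operator x a b j l =
    \sum_k \sum_i \sum_j curvature_matrix x i j k l * a 0 i * b 0 j * c 0 k.
  apply: eq_bigr => k _; rewrite /curvature_operator summxE mulr_sumr.
  apply: eq_bigr => i _; rewrite summxE mulr_sumr; apply: eq_bigr => j _.
  by rewrite mxE; ring.
rewrite [RHS]exchange_big /=; apply: eq_bigr => i _.
rewrite [RHS]exchange_big /=; apply: eq_bigr => j _.
by apply: eq_bigr => k _; rewrite riemannE.
Qed.

End LeviCivita.

(** * Symmetries of the curvature, and constant curvature *)

Section Inner.
Context {R : realType} {n : nat}.
Implicit Types (g : 'M[R]_n) (a b c : 'rV[R]_n).

Lemma innerDl g a b c : inner g (a + b) c = inner g a c + inner g b c.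
Proof. by rewrite /inner !mulmxDl mxE. Qed.

Lemma innerDr g a b c : inner g a (b + c) = inner g a b + inner g a c.
Proof. by rewrite /inner raddfD mulmxDr mxE. Qed.

Lemma innerZl g k a b : inner g (k *: a) b = k * inner g a b.
Proof. by rewrite /inner -!scalemxAl mxE. Qed.

Lemma innerZr g k a b : inner g a (k *: b) = k * inner g a b.
Proof. by rewrite /inner linearZ -scalemxAr mxE. Qed.

Lemma innerNl g a b : inner g (- a) b = - inner g a b.
Proof. by rewrite -scaleN1r innerZl mulN1r. Qed.

Lemma innerC g a b : g^T = g -> inner g a b = inner g b a.
Proof.
move=> gs; rewrite /inner -[in LHS](trmxK (a *m g *m b^T)) mxE.
by rewrite !trmx_mul gs trmxK mulmxA.
Qed.

Lemma inner0l g a : inner g 0 a = 0.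
Proof. by rewrite /inner !mul0mx mxE. Qed.

End Inner.

(** The first Bianchi identities for the four cyclic rotations of (a, b, c, d),
    combined with the two antisymmetries. *)
Lemma pair_symmetry (R : realFieldType) (T : Type) (Q : T -> T -> T -> T -> R) :
  (forall a b c d, Q a b c d = - Q b a c d) ->
  (forall a b c d, Q a b c d = - Q a b d c) ->
  (forall a b c d, Q a b c d + Q b c a d + Q c a b d = 0) ->
  forall a b c d, Q a b c d = Q c d a b.
Proof.
move=> s1 s2 bi a b c d.
have B1 := bi a b c d; have B2 := bi b c d a.
have B3 := bi c d a b; have B4 := bi d a b c.
have e1 := s2 b c d a; have e2 := s2 c d b a.
have e3 : Q d b c a = Q b d a c by rewrite s1 s2 opprK.
have e4 := s2 d a c b.
have e5 : Q a c d b = Q c a b d by rewrite s1 s2 opprK.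
have e6 := s2 a b d c.
lra.
Qed.

Lemma cyclic_difference (R : comRingType) (p q r s t u : R) :
  p - q + s + (q - r + t) + (r - p + u) = s + t + u.
Proof. ring. Qed.

Section TrilinearContraction.
Context {R : comRingType} {n : nat}.
Implicit Types (T : 'I_n -> 'I_n -> 'I_n -> R) (a b c : 'rV[R]_n).

(** The curvature operator is such a contraction, coordinate by coordinate. Its
    multilinearity and its behaviour under permutations of the arguments do not
    depend on the coefficients being those of a curvature. *)
Definition contract T a b c : R :=
  \sum_i \sum_j \sum_k T i j k * a 0 i * b 0 j * c 0 k.

Lemma contract_swap T a b c : contract T a b c = contract (fun i j k => T j i k) b a c.
Proof.
rewrite /contract [RHS]exchange_big /=; apply: eq_bigr => i _; apply: eq_bigr => j _.
by apply: eq_bigr => k _; rewrite (mulrAC (T i j k)).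
Qed.

Lemma contract_rot T a b c : contract T b c a = contract (fun i j k => T j k i) a b c.
Proof.
rewrite /contract; under eq_bigr do rewrite exchange_big /=.
rewrite exchange_big /=; apply: eq_bigr => i _; apply: eq_bigr => j _.
by apply: eq_bigr => k _; ring.
Qed.

Lemma contract_opp T a b c : contract (fun i j k => - T i j k) a b c = - contract T a b c.
Proof.
rewrite /contract -sumrN; apply: eq_bigr => i _; rewrite -sumrN.
by apply: eq_bigr => j _; rewrite -sumrN; apply: eq_bigr => k _; rewrite !mulNr.
Qed.

Lemma contract_add T1 T2 a b c :
  contract T1 a b c + contract T2 a b c = contract (fun i j k => T1 i j k + T2 i j k) a b c.
Proof.
rewrite /contract -big_split; apply: eq_bigr => i _; rewrite -big_split.
by apply: eq_bigr => j _; rewrite -big_split; apply: eq_bigr => k _; rewrite !mulrDl.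
Qed.

Lemma contract_eq0 T a b c : (forall i j k, T i j k = 0) -> contract T a b c = 0.
Proof.
by move=> T0; rewrite /contract big1// => i _; rewrite big1// => j _;
  rewrite big1// => k _; rewrite T0 !mul0r.
Qed.

Lemma eq_contract T1 T2 a b c :
  (forall i j k, T1 i j k = T2 i j k) -> contract T1 a b c = contract T2 a b c.
Proof.
by move=> TT; apply: eq_bigr => i _; apply: eq_bigr => j _; apply: eq_bigr => k _;
  rewrite TT.
Qed.

Lemma contractDl T a b c d : contract T (a + b) c d = contract T a c d + contract T b c d.
Proof.
rewrite /contract -big_split; apply: eq_bigr => i _; rewrite -big_split.
by apply: eq_bigr => j _; rewrite -big_split; apply: eq_bigr => k _;
  rewrite mxE mulrDr !mulrDl.
Qed.

Lemma contractZl T (s : R) a c d : contract T (s *: a) c d = s * contract T a c d.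
Proof.
rewrite /contract mulr_sumr; apply: eq_bigr => i _; rewrite mulr_sumr.
by apply: eq_bigr => j _; rewrite mulr_sumr; apply: eq_bigr => k _; rewrite mxE; ring.
Qed.

End TrilinearContraction.

Section CurvatureSymmetries.
Context {R : realType} {n : nat}.
Variables (W : set 'rV[R]_n) (G : 'rV[R]_n -> 'M[R]_n).
Hypotheses (W_open : open W) (G_smooth : smooth W G).
Hypotheses (G_sym : forall x, W x -> (G x)^T = G x).
Hypothesis G_unit : forall x, W x -> G x \in unitmx.
Variable x : 'rV[R]_n.
Hypothesis Wx : W x.
Implicit Types (a b c d : 'rV[R]_n) (i j k l : 'I_n).

Local Notation Q := (fun a b c d => inner (G x) (curvature G x a b c) d).

Lemma riemann_antisym i j l k : riemann G x l i j k = - riemann G x l j i k.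
Proof.
rewrite /riemann opprD opprB -sumrN; congr (_ + _).
by apply: eq_bigr => m _; rewrite opprB.
Qed.

(** The connection is torsion-free, so every derivative and every product occurs
    twice with opposite signs in the cyclic sum. *)
Lemma riemann_bianchi i j k l :
  riemann G x l i j k + riemann G x l j k i + riemann G x l k i j = 0.
Proof.
have E p q r : partial p (fun y => christoffel G y l q r) x
    = partial p (fun y => christoffel G y l r q) x.
  by apply: (eq_partial _ W_open Wx) => y Wy; exact: (christoffel_sym W_open G_sym).
rewrite /riemann (E i j k) (E j k i) (E k i j) cyclic_difference.
rewrite -!big_split /= big1// => m _.
rewrite (christoffel_sym W_open G_sym m k j Wx) (christoffel_sym W_open G_sym m i k Wx).
rewrite (christoffel_sym W_open G_sym m j i Wx).
move: (christoffel G x l i m) (christoffel G x l j m) (christoffel G x l k m).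
move: (christoffel G x m i j) (christoffel G x m i k) (christoffel G x m k j) => *.
ring.
Qed.

Lemma curvature_coord a b c l : (curvature G x a b c) 0 l = contract (riemann G x l) a b c.
Proof. by rewrite mxE. Qed.

Lemma curvature_antisym a b c : curvature G x a b c = - curvature G x b a c.
Proof.
apply/rowP => l; rewrite [RHS]mxE !curvature_coord contract_swap -contract_opp.
by apply: eq_contract => i j k; exact: riemann_antisym.
Qed.

Lemma curvature_bianchi a b c :
  curvature G x a b c + curvature G x b c a + curvature G x c a b = 0.
Proof.
apply/rowP => l; rewrite [LHS]mxE [X in X + _]mxE !curvature_coord [RHS]mxE.
rewrite (contract_rot _ b c a) !(contract_rot _ a b c).
rewrite !contract_add; apply: contract_eq0 => i j k; exact: riemann_bianchi.
Qed.

Lemma curvature_skew a b c d : Q a b c d = - Q a b d c.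
Proof.
have skew : curvature_operator G x a b *m G x = - (G x *m (curvature_operator G x a b)^T).
  apply/eqP; rewrite -addr_eq0; apply/eqP.
  rewrite /curvature_operator mulmx_suml raddf_sum mulmx_sumr -big_split /= big1// => i _.
  rewrite mulmx_suml raddf_sum mulmx_sumr -big_split /= big1// => j _.
  rewrite linearZ /= -scalemxAl -scalemxAr -scalerDr.
  by rewrite (curvature_matrix_skew W_open G_smooth G_sym G_unit i j Wx) scaler0.
rewrite !(curvatureE W_open G_smooth G_unit _ _ _ Wx).
rewrite [in RHS](innerC _ _ (G_sym Wx)) /inner -[c *m _ *m _]mulmxA skew.
by rewrite trmx_mul mulmxN mulNmx mxE !mulmxA.
Qed.

Lemma curvature_pair_symmetry a b c d : Q a b c d = Q c d a b.
Proof.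
apply: (@pair_symmetry R _ Q) => {}a {}b {}c {}d.
- by rewrite curvature_antisym innerNl.
- exact: curvature_skew.
- by rewrite -!innerDl curvature_bianchi inner0l.
Qed.

Lemma curvatureDl a b c d : curvature G x (a + b) c d = curvature G x a c d + curvature G x b c d.
Proof. by apply/rowP => l; rewrite [RHS]mxE !curvature_coord contractDl. Qed.

Lemma curvatureZl (s : R) a c d : curvature G x (s *: a) c d = s *: curvature G x a c d.
Proof. by apply/rowP => l; rewrite [RHS]mxE !curvature_coord contractZl. Qed.

Variable L0 : R.
Hypothesis curv_L0 : forall a b, plane_det G x a b != 0 -> sectional G x a b = L0.

Lemma constant_curvature_sectional a b : plane_det G x a b != 0 ->
  Q a b b a = L0 * plane_det G x a b.
Proof. by move=> ab0; rewrite -(curv_L0 ab0) /sectional divfK. Qed.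

(** Polarization. The planes of (a + s c, b) and (a - s c, b) have the same
    determinant, hence the same sectional numerator, and the difference of the
    two numerators is 4 s R(a, b, b, c), because pair symmetry identifies the
    two mixed terms. *)
Lemma constant_curvature_orthogonal a b c :
  inner (G x) a a != 0 -> inner (G x) b b != 0 ->
  inner (G x) a b = 0 -> inner (G x) a c = 0 -> inner (G x) b c = 0 ->
  Q a b b c = 0.
Proof.
move=> aa bb ab ac bc.
have ba : inner (G x) b a = 0 by rewrite innerC ?G_sym.
have ca : inner (G x) c a = 0 by rewrite innerC ?G_sym.
have cb : inner (G x) c b = 0 by rewrite innerC ?G_sym.
have det s : plane_det G x (a + s *: c) b
    = (inner (G x) a a + s ^+ 2 * inner (G x) c c) * inner (G x) b b.
  rewrite /plane_det !innerDl !innerDr !innerZl !innerZr ab ac ca cb; ring.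
have expand s : Q (a + s *: c) b b (a + s *: c)
    = Q a b b a + s ^+ 2 * Q c b b c + 2 * s * Q a b b c.
  rewrite !curvatureDl !curvatureZl !innerDl !innerDr !innerZl !innerZr.
  rewrite (curvature_pair_symmetry c b b a) (curvature_antisym b a c).
  rewrite innerNl [in - _](curvature_skew a b c b); ring.
have key s : s != 0 -> inner (G x) a a + s ^+ 2 * inner (G x) c c != 0 ->
    Q a b b c = 0.
  move=> s0 nz.
  have h1 : plane_det G x (a + s *: c) b != 0 by rewrite det mulf_neq0.
  have h2 : plane_det G x (a + (- s) *: c) b != 0 by rewrite det sqrrN mulf_neq0.
  have := constant_curvature_sectional h1; have := constant_curvature_sectional h2.
  rewrite !expand !det sqrrN => e2 e1.
  have : 4 * s * Q a b b c = 0 by lra.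
  by move/eqP; rewrite mulf_eq0 mulf_eq0 pnatr_eq0 (negbTE s0) /= => /eqP.
(* The value s = 1 may give a degenerate plane; if it does, s = 2 does not,
   because a is not null. *)
have [e1|] := eqVneq (inner (G x) a a + 1 ^+ 2 * inner (G x) c c) 0; last exact: key.
apply: (key 2) => //.
by apply: contra_neq aa => e2; lra.
Qed.

End CurvatureSymmetries.

(** * Covariant derivative along a map *)

(** Collects into one double sum the terms of a commutator of covariant
    derivatives that are quadratic in the velocities a and b of the map. *)
Lemma quadratic_commutator (R : comRingType) n (B : 'I_n -> 'M[R]_n)
    (dB : 'I_n -> 'I_n -> 'M[R]_n) (a b : 'I_n -> R) :
  \sum_i \sum_j (b i * a j) *: dB j i - \sum_i \sum_j (a i * b j) *: dB j i
  + ((\sum_i b i *: B i) *m (\sum_i a i *: B i)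
     - (\sum_i a i *: B i) *m (\sum_i b i *: B i))
  = \sum_i \sum_j (a i * b j) *: (dB i j - dB j i + (B j *m B i - B i *m B j)).
Proof.
have prod (c d : 'I_n -> R) : (\sum_i c i *: B i) *m (\sum_i d i *: B i)
    = \sum_i \sum_j (c i * d j) *: (B i *m B j).
  rewrite mulmx_suml; apply: eq_bigr => i _; rewrite mulmx_sumr.
  by apply: eq_bigr => j _; rewrite -scalemxAl -scalemxAr scalerA.
rewrite !prod exchange_big /= [X in _ + (X - _)]exchange_big /=.
rewrite -!sumrB -big_split; apply: eq_bigr => i _ /=.
rewrite -!sumrB -big_split; apply: eq_bigr => j _ /=.
by rewrite ![b j * a i]mulrC -!scalerBr -scalerDr.
Qed.

Lemma commutator_cancel (R : comRingType) n (a b c d e c' e' : 'rV[R]_n) :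
  a + b + c + d + e - (a + d + c' + b + e') = c - c' + (e - e').
Proof. by apply/rowP => i; rewrite !mxE; ring. Qed.

Section CovariantDerivative.
Context {R : realType} {m n : nat}.
Variables (W : set 'rV[R]_n) (G : 'rV[R]_n -> 'M[R]_n).
Hypotheses (W_open : open W) (G_smooth : smooth W G).
Hypotheses (G_sym : forall y, W y -> (G y)^T = G y).
Hypothesis G_unit : forall y, W y -> G y \in unitmx.
Variables (U : set 'rV[R]_m) (x : 'rV[R]_m -> 'rV[R]_n).
Hypotheses (U_open : open U) (x_smooth : smooth U x).
Hypothesis xU : forall p, U p -> W (x p).
Implicit Types (X Y : 'rV[R]_m -> 'rV[R]_n) (k l : 'I_m) (p : 'rV[R]_m).

(** This form makes the derivative convertible to nabla, along the map into the
    manifold, read in one chart. *)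
Definition cov k X p : 'rV[R]_n :=
  partial k X p + christoffel_form G (x p) (partial k x p) (X p).

Local Notation Gamma k p := (connection_along G (x p) (partial k x p)).

Lemma covE k X p : cov k X p = partial k X p + X p *m Gamma k p.
Proof. by rewrite /cov christoffel_formE. Qed.

Lemma differentiable_x p : U p -> differentiable x p.
Proof. by move=> Up; exact: smooth_differentiable Up. Qed.

Lemma differentiable_Gx p : U p -> differentiable (fun q => G (x q)) p.
Proof.
move=> Up; apply: (@differentiable_comp _ _ _ _ x G) => //; first exact: differentiable_x.
exact: differentiable_metric (xU Up).
Qed.

Lemma partial_Gx k p : U p ->
  partial k (fun q => G (x q)) p = Gamma k p *m G (x p) + G (x p) *m (Gamma k p)^T.
Proof.
move=> Up; have dG := differentiable_metric G_smooth (xU Up).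
rewrite {1}/partial (derive_comp _ (differentiable_x Up) dG) derive_partial//.
rewrite /connection_along mulmx_suml raddf_sum mulmx_sumr -big_split /=.
apply: eq_bigr => i _; rewrite (partial_metric W_open G_smooth G_sym G_unit i (xU Up)).
by rewrite linearZ /= -scalemxAl -scalemxAr scalerDr.
Qed.

Lemma differentiable_inner X Y p : U p -> differentiable X p -> differentiable Y p ->
  differentiable (fun q => inner (G (x q)) (X q) (Y q)) p.
Proof.
move=> Up dX dY; apply: (@differentiable_entry _ _ _ _ _ p 0 0).
apply: differentiable_mulmx; last exact: differentiable_trmx.
by apply: differentiable_mulmx => //; exact: differentiable_Gx.
Qed.

(** Metric compatibility along the map, by the chain rule. *)
Lemma partial_inner k X Y p : U p -> differentiable X p -> differentiable Y p ->
  partial k (fun q => inner (G (x q)) (X q) (Y q)) p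
  = inner (G (x p)) (cov k X p) (Y p) + inner (G (x p)) (X p) (cov k Y p).
Proof.
move=> Up dX dY.
have dG := differentiable_Gx Up.
have dXG := differentiable_mulmx dX dG.
have dYT := differentiable_trmx dY.
rewrite /partial -(derive_entry _ 0 0 (differentiable_mulmx dXG dYT)).
rewrite (derive_mulmx _ dXG dYT) (derive_mulmx _ dX dG) (derive_trmx _ dY).
rewrite -/(partial k (fun q => G (x q)) p) (partial_Gx k Up) !covE /inner /partial.
set dx := 'D__ X p; set dy := 'D__ Y p; set ga := connection_along _ _ _.
move: dx dy ga (G (x p)) (X p) (Y p) => {dG dXG dYT} dx dy ga g X0 Y0.
have -> : (dy + Y0 *m ga)^T = dy^T + ga^T *m Y0^T.
  by rewrite -trmx_mul raddfD.
rewrite !mulmxDl !mulmxDr !mulmxDl !mulmxA.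
set t1 := dx *m g *m _; set t2 := X0 *m ga *m g *m _.
set t3 := X0 *m g *m _ *m _; set t4 := X0 *m g *m _.
by clearbody t1 t2 t3 t4; rewrite !mxE addrA -addrA [t3 _ _ + _]addrC.
Qed.

Lemma christoffel_form_sym y a b : W y -> christoffel_form G y a b = christoffel_form G y b a.
Proof.
move=> Wy; apply/rowP => l; rewrite !mxE exchange_big /=.
apply: eq_bigr => j _; apply: eq_bigr => i _.
by rewrite (christoffel_sym W_open G_sym l i j Wy) mulrAC.
Qed.

(** The second derivatives of x commute and the Christoffel symbols are
    symmetric. *)
Lemma cov_partial_sym k l p : U p -> cov k (partial l x) p = cov l (partial k x) p.
Proof.
move=> Up.
exact: (f_equal2 +%R (schwarz k l U_open Up x_smooth) (christoffel_form_sym _ _ (xU Up))).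
Qed.

Lemma differentiable_Gamma k p : U p -> differentiable (fun q => Gamma k q) p.
Proof.
move=> Up; apply: differentiable_sumr => i _.
apply: differentiable_mx => a b; under eq_fun do rewrite mxE.
have dp := smooth_differentiable (smooth_partial k x_smooth) Up.
apply: differentiableM; first exact: differentiable_entry.
apply: differentiable_entry; apply: (@differentiable_comp _ _ _ _ x) => //.
  exact: differentiable_x.
exact: (differentiable_connection W_open G_smooth G_unit i (xU Up)).
Qed.

Lemma differentiable_cov k X p : U p -> smooth U X -> differentiable (cov k X) p.
Proof.
move=> Up sX; rewrite (_ : cov k X = fun q => partial k X q + X q *m Gamma k q); last first.
  by apply/funext => q; rewrite covE.
apply: differentiableD; first exact: smooth_differentiable (smooth_partial k sX) Up.
by apply: differentiable_mulmx; [exact: smooth_differentiable Up|exact: differentiable_Gamma].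
Qed.

Lemma partial_Gamma k l p : U p ->
  partial k (fun q => Gamma l q) p
  = \sum_i (partial k (partial l x) p) 0 i *: connection_matrix G i (x p)
    + \sum_i \sum_j (partial l x p 0 i * partial k x p 0 j)
        *: partial j (connection_matrix G i) (x p).
Proof.
move=> Up.
have dp := smooth_differentiable (smooth_partial l x_smooth) Up.
have dA i := differentiable_connection W_open G_smooth G_unit i (xU Up).
have dAx i : differentiable (fun q => connection_matrix G i (x q)) p.
  by apply: (@differentiable_comp _ _ _ _ x) => //; exact: differentiable_x.
have dcoef i := differentiable_entry 0 i dp.
have dterm i : differentiable (fun q => partial l x q 0 i *: connection_matrix G i (x q)) p.
  apply: differentiable_mx => a b; under eq_fun do rewrite mxE.
  by apply: differentiableM => //; exact: differentiable_entry.
rewrite {1}/partial (derive_sumr _ dterm) -big_split; apply: eq_bigr => i _ /=.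
apply/matrixP => a b; rewrite (derive_entry _ _ _ (dterm i)).
rewrite (_ : (fun q => _) =
  (fun q => partial l x q 0 i * connection_matrix G i (x q) a b)); last first.
  by apply/funext => q; rewrite mxE.
rewrite deriveM; [|exact: diff_derivable|by apply: diff_derivable; exact: differentiable_entry].
rewrite -(derive_entry _ _ _ dp) -(derive_entry _ _ _ (dAx i)).
rewrite (derive_comp _ (differentiable_x Up) (dA i)) (derive_partial _ (dA i)).
rewrite [RHS]mxE addrC; congr (_ + _).
  rewrite !summxE scaler_sumr; apply: eq_bigr => j _.
  by rewrite [in LHS]mxE [RHS]mxE -[LHS]/(_ * _) mulrA.
by rewrite [RHS]mxE -[LHS]/(_ * _) mulrC.
Qed.

(** The second derivatives of X cancel, and those of x cancel between the two
    derivatives of the connection; the curvature of the target, contracted with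
    the velocities, is all that remains. *)
Lemma cov_commutator k l X p : U p -> smooth U X ->
  cov k (cov l X) p - cov l (cov k X) p
  = curvature G (x p) (partial k x p) (partial l x p) (X p).
Proof.
move=> Up sX.
have second u v : cov u (cov v X) p
    = partial u (partial v X) p + partial u X p *m Gamma v p
      + X p *m partial u (fun q => Gamma v q) p
      + partial v X p *m Gamma u p + X p *m (Gamma v p *m Gamma u p).
  have dX := smooth_differentiable sX Up.
  have dpX := smooth_differentiable (smooth_partial v sX) Up.
  have dXG := differentiable_mulmx dX (differentiable_Gamma v Up).
  rewrite covE {1}/partial (_ : cov v X = fun q => partial v X q + X q *m Gamma v q); last first.
    by apply/funext => q; rewrite covE.
  rewrite (deriveD (diff_derivable dpX) (diff_derivable dXG)).
  rewrite (derive_mulmx _ dX (differentiable_Gamma v Up)).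
  by rewrite mulmxDl mulmxA !addrA.
have swap : partial k (fun q => Gamma l q) p - partial l (fun q => Gamma k q) p
    + (Gamma l p *m Gamma k p - Gamma k p *m Gamma l p)
    = curvature_operator G (x p) (partial k x p) (partial l x p).
  rewrite (partial_Gamma k l Up) (partial_Gamma l k Up) (schwarz l k U_open Up x_smooth).
  by rewrite opprD [X in X + (_ *m _ - _)]addrACA subrr add0r quadratic_commutator.
rewrite (curvatureE W_open G_smooth G_unit _ _ _ (xU Up)) -swap.
apply: etrans (f_equal2 (fun u v => u - v) (second k l) (second l k)) _.
rewrite (schwarz l k U_open Up sX).
rewrite !mulmxDr !mulmxN.
exact: commutator_cancel.
Qed.

End CovariantDerivative.

(** * Orthogonal frames *)

Lemma forall_ord2 (P : 'I_2 -> Prop) : P 0 -> P 1 -> forall i, P i.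
Proof.
move=> P0 P1 [[|[|//]] Hi].
  by rewrite (_ : Ordinal Hi = 0)//; exact: val_inj.
by rewrite (_ : Ordinal Hi = 1)//; exact: val_inj.
Qed.

Section Frames.
Context {R : realType} {n : nat}.
Variables (g : 'M[R]_n) (f : 'I_n -> 'rV[R]_n) (s : 'I_n -> R).
Hypothesis s_neq0 : forall i, s i != 0.
Hypothesis f_orth : forall i j, inner g (f i) (f j) = if i == j then s i else 0.

(** If B has the frame as its rows, then B g B^T is diagonal and invertible, so
    g B^T times the inverse of this diagonal matrix is a right inverse of B. A
    right inverse of a square matrix is also a left inverse, and inserting it
    between a and g b^T gives the expansion. *)
Lemma orthogonal_frame_expansion a b :
  inner g a b = \sum_i (s i)^-1 * (inner g a (f i) * inner g (f i) b).
Proof.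
pose B : 'M[R]_n := \matrix_i f i.
pose Sinv : 'M[R]_n := diag_mx (\row_i (s i)^-1).
have rowB i : row i B = f i by rewrite rowK.
have colB (v : 'rV[R]_n) i : (v *m B^T) 0 i = (v *m (f i)^T) 0 0.
  by rewrite !mxE; apply: eq_bigr => k _; rewrite !mxE.
have BgB : B *m g *m B^T = diag_mx (\row_i s i).
  apply/matrixP => i j.
  have -> : (B *m g *m B^T) i j = (row i (B *m g *m B^T)) 0 j.
    by rewrite [RHS]mxE.
  rewrite !row_mul rowB colB -/(inner g (f i) (f j)) f_orth !mxE.
  by case: eqP => [->|_]; rewrite ?mulr1n ?mulr0n.
have inv : g *m B^T *m Sinv *m B = 1%:M.
  apply: mulmx1C; rewrite !mulmxA BgB mulmx_diag.
  by apply/matrixP => i j; rewrite !mxE divff.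
have -> : inner g a b = ((a *m g *m B^T) *m Sinv *m (B *m g *m b^T)) 0 0.
  have -> : a *m g *m B^T *m Sinv *m (B *m g *m b^T)
      = a *m (g *m B^T *m Sinv *m B) *m (g *m b^T) by rewrite !mulmxA.
  by rewrite inv mulmx1 mulmxA.
rewrite mxE; apply: eq_bigr => i _.
rewrite mul_mx_diag mxE [(\row_j _) 0 i]mxE colB -/(inner g a (f i)).
have -> : (B *m g *m b^T) i 0 = (row i (B *m g *m b^T)) 0 0.
  by rewrite [RHS]mxE.
rewrite !row_mul rowB -/(inner g (f i) b).
by rewrite mulrAC mulrC mulrA.
Qed.

End Frames.

(** * The curvature of a conformally flat Lorentz metric *)

Lemma christoffel_lorentz_algebra (R : realFieldType) (d : 'I_2 -> R)
    (l i j : 'I_2) (e : R) : e != 0 ->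
  2^-1 * (e^-1 * (-1) ^+ l *
   ((if j == l then (-1) ^+ j * (2 * d i * e) else 0) +
    (if i == l then (-1) ^+ i * (2 * d j * e) else 0) -
    (if i == j then (-1) ^+ i * (2 * d l * e) else 0)))
  = (if j == l then d i else 0) + (if i == l then d j else 0)
    - (if i == j then (-1) ^+ i * (-1) ^+ l * d l else 0).
Proof.
move=> e0.
elim/forall_ord2: l; elim/forall_ord2: i; elim/forall_ord2: j;
  by rewrite /= ?expr0 ?expr1; field.
Qed.

Lemma contract_delta (R : comRingType) n (T : 'I_n -> 'I_n -> 'I_n -> R) i j k :
  contract T (delta_mx 0 i) (delta_mx 0 j) (delta_mx 0 k) = T i j k.
Proof.
rewrite /contract (bigD1 i)//= [X in _ + X]big1 => [|a ai]; last first.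
  rewrite big1// => b _; rewrite big1// => c _.
  by rewrite !mxE (negbTE ai) andbF mulr0 !mul0r.
rewrite addr0 (bigD1 j)//= [X in _ + X]big1 => [|b bj]; last first.
  by rewrite big1// => c _; rewrite !mxE (negbTE bj) andbF mulr0 !mul0r.
rewrite addr0 (bigD1 k)//= [X in _ + X]big1 => [|c ck]; last first.
  by rewrite !mxE (negbTE ck) andbF mulr0.
by rewrite addr0 !mxE !eqxx !mulr1.
Qed.

Section LorentzCurvature.
Context {R : realType}.
Variables (U : set 'rV[R]_2) (lam : 'rV[R]_2 -> R).
Hypotheses (U_open : open U) (lam_smooth : smooth U lam).

Local Notation E p := (expR (2 * lam p)).
Local Notation g := (lorentz_metric lam).

Lemma lorentz_metricE p (i j : 'I_2) :
  g p i j = if i == j then (-1) ^+ i * E p else 0.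
Proof.
rewrite !mxE; case: eqP => [->|_]; last by rewrite mulr0n mulr0.
by rewrite mulr1n mulrC.
Qed.

Lemma invmx_lorentz_metric p :
  invmx (g p) = (E p)^-1 *: diag_mx (\row_(k < 2) (-1) ^+ k).
Proof.
have gK : g p *m ((E p)^-1 *: diag_mx (\row_(k < 2) (-1) ^+ k)) = 1%:M.
  rewrite /lorentz_metric -scalemxAl -scalemxAr scalerA divff ?gt_eqF ?expR_gt0//.
  rewrite scale1r mulmx_diag; apply/matrixP => i j; rewrite !mxE -expr2 sqrr_sign.
  by [].
have [ug _] := mulmx1_unit gK.
by rewrite -[LHS]mulmx1 -gK mulKmx.
Qed.

Lemma differentiable_lam p : U p -> differentiable lam p.
Proof. by move=> Up; exact: smooth_differentiable Up. Qed.

Lemma differentiable_E p : U p -> differentiable (fun q => E q) p.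
Proof.
move=> Up; apply: differentiable_expR; apply: differentiableM.
  exact: differentiable_cst.
exact: differentiable_lam.
Qed.

Lemma partial_E k p : U p -> partial k (fun q => E q) p = 2 * partial k lam p * E p.
Proof.
move=> Up; have dl := differentiable_lam Up.
rewrite partial_expR; last by apply: differentiableM => //; exact: differentiable_cst.
congr (_ * _); rewrite /partial.
exact: (deriveZ 2 (diff_derivable dl)).
Qed.

Lemma partial_lorentz_metric k (i j : 'I_2) p : U p ->
  partial k (fun q => g q i j) p
  = if i == j then (-1) ^+ i * (2 * partial k lam p * E p) else 0.
Proof.
move=> Up; under [X in partial k X]eq_fun do rewrite lorentz_metricE.
case: eqP => _; last by rewrite /partial derive_cst.
rewrite -partial_E// /partial.
exact: (deriveZ ((-1) ^+ i) (diff_derivable (differentiable_E Up))).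
Qed.

(** The metric is diagonal with equal or opposite entries, so the only
    derivatives that survive are those of its conformal factor. *)
Lemma christoffel_lorentz p (l i j : 'I_2) : U p ->
  christoffel g p l i j
  = (if j == l then partial i lam p else 0) + (if i == l then partial j lam p else 0)
    - (if i == j then (-1) ^+ i * (-1) ^+ l * partial l lam p else 0).
Proof.
move=> Up; rewrite /christoffel invmx_lorentz_metric (bigD1 l)//= big1 => [|m ml].
  rewrite !partial_lorentz_metric// !mxE eqxx mulr1n addr0.
  have E0 : E p != 0 by rewrite gt_eqF ?expR_gt0.
  exact: (christoffel_lorentz_algebra (fun k => partial k lam p)).
by rewrite !mxE (negbTE (_ : l != m)) ?mulr0n ?mulr0 ?mul0r// eq_sym.
Qed.

(** The products of Christoffel symbols cancel in the coefficient of the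
    curvature tensor that enters the curvature of the plane, and its linear part
    is the wave operator applied to lam. *)
Lemma gauss_curvature_lorentz p : U p ->
  gauss_curvature g p
  = - (partial 0 (partial 0 lam) p - partial 1 (partial 1 lam) p) / E p.
Proof.
move=> Up.
have E0 : E p != 0 by rewrite gt_eqF ?expR_gt0.
have innerE (a : 'rV[R]_2) k : inner (g p) a (delta_mx 0 k) = a 0 k * (-1) ^+ k * E p.
  rewrite /inner trmx_delta -colE mxE mxE (bigD1 k)//= big1 => [|m mk].
    by rewrite lorentz_metricE eqxx addr0 mulrA.
  by rewrite lorentz_metricE (negbTE mk) mulr0.
have c11 : forall q, U q -> christoffel g q 0 1 1 = partial 0 lam q.
  by move=> q Uq; rewrite christoffel_lorentz//= expr0 expr1; ring.
have c01 : forall q, U q -> christoffel g q 0 0 1 = partial 1 lam q.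
  by move=> q Uq; rewrite christoffel_lorentz//=; ring.
have curv : curvature g p (delta_mx 0 0) (delta_mx 0 1) (delta_mx 0 1) 0 0
    = partial 0 (partial 0 lam) p - partial 1 (partial 1 lam) p.
  rewrite curvature_coord contract_delta /riemann.
  rewrite (eq_partial _ U_open Up c11) (eq_partial _ U_open Up c01).
  rewrite !big_ord_recl big_ord0 (_ : lift ord0 ord0 = 1); last exact: val_inj.
  rewrite (_ : ord0 = 0)// !(christoffel_lorentz _ _ _ Up) /=.
  move: (partial 0 (partial 0 lam) p) (partial 1 (partial 1 lam) p).
  move: (partial 0 lam p) (partial 1 lam p) => d0 d1 d00 d11.
  by rewrite ?expr0 ?expr1; ring.
rewrite /gauss_curvature /sectional /plane_det !innerE curv !mxE /= !expr0 !expr1.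
move: (partial 0 (partial 0 lam) p) (partial 1 (partial 1 lam) p) (E p) E0 => d0 d1 e e0.
by field.
Qed.

End LorentzCurvature.

Lemma expansion4 (R : realType) (g : 'M[R]_4) (f1 f2 f3 f4 a b : 'rV[R]_4) (e : R) :
  g^T = g -> e != 0 ->
  inner g f1 f1 = e -> inner g f2 f2 = - e -> inner g f3 f3 = e -> inner g f4 f4 = - e ->
  inner g f1 f2 = 0 -> inner g f1 f3 = 0 -> inner g f1 f4 = 0 ->
  inner g f2 f3 = 0 -> inner g f2 f4 = 0 -> inner g f3 f4 = 0 ->
  e * inner g a b = inner g a f1 * inner g b f1 - inner g a f2 * inner g b f2
                    + inner g a f3 * inner g b f3 - inner g a f4 * inner g b f4.
Proof.
move=> gs e0 h11 h22 h33 h44 h12 h13 h14 h23 h24 h34.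
pose f (i : 'I_4) := nth 0 [:: f1; f2; f3; f4] i.
pose s (i : 'I_4) := nth 0 [:: e; - e; e; - e] i.
have s0 i : s i != 0.
  by case: i => [[|[|[|[|//]]]] Hi]; rewrite /s/= ?oppr_eq0.
have fs i j : inner g (f i) (f j) = if i == j then s i else 0.
  have C u v : inner g u v = inner g v u by exact: innerC.
  case: i => [[|[|[|[|//]]]] Hi]; case: j => [[|[|[|[|//]]]] Hj];
    by rewrite /f /s -(inj_eq val_inj) /= ?h11 ?h22 ?h33 ?h44 ?h12 ?h13 ?h14 ?h23 ?h24 ?h34
      // C ?h12 ?h13 ?h14 ?h23 ?h24 ?h34.
rewrite (orthogonal_frame_expansion s0 fs a b) !big_ord_recl big_ord0 /f /s /=.
rewrite !(innerC _ b gs).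
move: (inner g a f1) (inner g a f2) (inner g a f3) (inner g a f4) => x1 x2 x3 x4.
move: (inner g f1 b) (inner g f2 b) (inner g f3 b) (inner g f4 b) => y1 y2 y3 y4.
by field.
Qed.

(** * The equations of Gauss and Codazzi *)

Lemma partial_constant (R : realType) m k (c : R) (p : 'rV[R]_m) :
  partial k (fun=> c) p = 0 :> R.
Proof. by rewrite /partial derive_cst. Qed.

Lemma partial_opp (R : realType) m k (f : 'rV[R]_m -> R) p : differentiable f p ->
  partial k (fun q => - f q) p = - partial k f p.
Proof. by move=> df; exact: (deriveN (diff_derivable df)). Qed.

Lemma partial_mul (R : realType) m k (f g : 'rV[R]_m -> R) p :
  differentiable f p -> differentiable g p ->
  partial k (fun q => f q * g q) p = partial k f p * g p + f p * partial k g p.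
Proof.
move=> df dg.
rewrite /partial (deriveM (diff_derivable df) (diff_derivable dg)) addrC.
by rewrite /GRing.scale /= mulrC.
Qed.

(** The entries (0, 0), (0, 1), (1, 1) of a symmetric array are numbered by 0,
    1, 2. *)
Definition sym_index (a b : 'I_2) : 'I_3 := (a + b)%N%:R.

(** What the computations with the surface use: the products of the frame T 0, T
    1, n1, n2 and of its covariant derivatives, the compatibility of the product
    h with the derivation D, and the two curvature identities that constant
    curvature gives for the tangent plane. The field e is the conformal factor,
    l k the derivatives of half its logarithm, mu the normal connection, al and
    be the second fundamental form. *)
Record adapted_frame (R : realType) (V : normedModType R)
    (U : set 'rV[R]_2) (h : 'rV[R]_2 -> V -> V -> R)
    (D : 'I_2 -> ('rV[R]_2 -> V) -> 'rV[R]_2 -> V)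
    (T : 'I_2 -> 'rV[R]_2 -> V) (n1 n2 : 'rV[R]_2 -> V)
    (e : 'rV[R]_2 -> R) (l mu : 'I_2 -> 'rV[R]_2 -> R)
    (al be : 'rV[R]_2 -> 'rV[R]_3) (L0 : R) : Prop := AdaptedFrame {
  frame_U_open : open U ;
  frame_hC : forall p a b, U p -> h p a b = h p b a ;
  frame_expansion : forall p a b, U p ->
    e p * h p a b = h p a (T 0 p) * h p b (T 0 p) - h p a (T 1 p) * h p b (T 1 p)
                    + h p a (n1 p) * h p b (n1 p) - h p a (n2 p) * h p b (n2 p) ;
  frame_e_neq0 : forall p, e p != 0 ;
  frame_e_differentiable : forall p, U p -> differentiable e p ;
  frame_l_differentiable : forall k p, U p -> differentiable (l k) p ;
  frame_partial_e : forall k p, U p -> partial k e p = 2 * l k p * e p ;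
  frame_partial_h : forall k X Y p, U p -> differentiable X p -> differentiable Y p ->
    partial k (fun q => h q (X q) (Y q)) p = h p (D k X p) (Y p) + h p (X p) (D k Y p) ;
  frame_T_differentiable : forall k p, U p -> differentiable (T k) p ;
  frame_DT_differentiable : forall a b p, U p -> differentiable (D a (T b)) p ;
  frame_n1_differentiable : forall p, U p -> differentiable n1 p ;
  frame_n2_differentiable : forall p, U p -> differentiable n2 p ;
  frame_DT_sym : forall a b p, U p -> D a (T b) p = D b (T a) p ;
  frame_T00 : forall p, U p -> h p (T 0 p) (T 0 p) = e p ;
  frame_T11 : forall p, U p -> h p (T 1 p) (T 1 p) = - e p ;
  frame_T01 : forall p, U p -> h p (T 0 p) (T 1 p) = 0 ;
  frame_sigma1 : forall p, U p -> forall a b,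
    h p (D a (T b) p) (n1 p) = al p 0 (sym_index a b) * e p ;
  frame_sigma2 : forall p, U p -> forall a b,
    h p (D a (T b) p) (n2 p) = - (be p 0 (sym_index a b) * e p) ;
  frame_conn11 : forall p, U p -> forall k, h p (D k n1 p) (n1 p) = l k p * e p ;
  frame_conn12 : forall p, U p -> forall k, h p (D k n1 p) (n2 p) = - (mu k p * e p) ;
  frame_conn21 : forall p, U p -> forall k, h p (D k n2 p) (n1 p) = mu k p * e p ;
  frame_conn22 : forall p, U p -> forall k, h p (D k n2 p) (n2 p) = - (l k p * e p) ;
  frame_curvature_tangent : forall p, U p ->
    h p (D 0 (D 1 (T 1)) p) (T 0 p) - h p (D 1 (D 0 (T 1)) p) (T 0 p) = - (L0 * e p ^+ 2) ;
  frame_curvature_normal : forall p, U p -> forall b v,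
    h p v (T 0 p) = 0 -> h p v (T 1 p) = 0 ->
    h p (D 0 (D 1 (T b)) p) v = h p (D 1 (D 0 (T b)) p) v
}.

Section MovingFrame.
Context {R : realType} {V : normedModType R}.
Variables (U : set 'rV[R]_2) (h : 'rV[R]_2 -> V -> V -> R).
Variable D : 'I_2 -> ('rV[R]_2 -> V) -> 'rV[R]_2 -> V.
Variables (T : 'I_2 -> 'rV[R]_2 -> V) (n1 n2 : 'rV[R]_2 -> V).
Variables (e : 'rV[R]_2 -> R) (l mu : 'I_2 -> 'rV[R]_2 -> R).
Variables (al be : 'rV[R]_2 -> 'rV[R]_3) (L0 : R).
Hypothesis frame : adapted_frame U h D T n1 n2 e l mu al be L0.

Local Notation U_open := (frame_U_open frame).
Local Notation hC := (frame_hC frame).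
Local Notation expansion := (frame_expansion frame).
Local Notation e_neq0 := (frame_e_neq0 frame).
Local Notation e_differentiable := (frame_e_differentiable frame).
Local Notation l_differentiable := (frame_l_differentiable frame).
Local Notation partial_e := (frame_partial_e frame).
Local Notation partial_h := (frame_partial_h frame).
Local Notation T_differentiable := (frame_T_differentiable frame).
Local Notation DT_differentiable := (frame_DT_differentiable frame).
Local Notation n1_differentiable := (frame_n1_differentiable frame).
Local Notation n2_differentiable := (frame_n2_differentiable frame).
Local Notation DT_sym := (frame_DT_sym frame).
Local Notation T00 := (frame_T00 frame).
Local Notation T11 := (frame_T11 frame).
Local Notation T01 := (frame_T01 frame).
Local Notation sigma1 := (frame_sigma1 frame).
Local Notation sigma2 := (frame_sigma2 frame).
Local Notation conn11 := (frame_conn11 frame).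
Local Notation conn12 := (frame_conn12 frame).
Local Notation conn21 := (frame_conn21 frame).
Local Notation conn22 := (frame_conn22 frame).
Local Notation curvature_tangent := (frame_curvature_tangent frame).
Local Notation curvature_normal := (frame_curvature_normal frame).

Lemma partial_h_eq k X Y p (f : 'rV[R]_2 -> R) :
  (forall q, U q -> h q (X q) (Y q) = f q) ->
  U p -> differentiable X p -> differentiable Y p ->
  h p (D k X p) (Y p) + h p (X p) (D k Y p) = partial k f p.
Proof.
by move=> hf Up dX dY; rewrite -partial_h//; exact: eq_partial U_open Up hf.
Qed.

Lemma koszul_eq k a b p f : U p -> (forall q, U q -> h q (T a q) (T b q) = f q) ->
  h p (D k (T a) p) (T b p) + h p (D k (T b) p) (T a p) = partial k f p.
Proof.
move=> Up hf; rewrite -(partial_h_eq k hf Up (T_differentiable a Up) (T_differentiable b Up)).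
by congr (_ + _); rewrite hC.
Qed.

(** Differentiating the known products of T 0 and T 1 gives six linear equations
    for six unknowns; these are the Christoffel symbols of the induced metric. *)
Lemma tangential_coefficients p : U p ->
  [/\ h p (D 0 (T 0) p) (T 0 p) = l 0 p * e p,
      h p (D 0 (T 0) p) (T 1 p) = - (l 1 p * e p),
      h p (D 0 (T 1) p) (T 0 p) = l 1 p * e p &
      h p (D 0 (T 1) p) (T 1 p) = - (l 0 p * e p)] /\
  (h p (D 1 (T 1) p) (T 0 p) = l 0 p * e p /\
   h p (D 1 (T 1) p) (T 1 p) = - (l 1 p * e p)).
Proof.
move=> Up.
have := koszul_eq 0 Up T00; have := koszul_eq 0 Up T01; have := koszul_eq 0 Up T11.
have := koszul_eq 1 Up T00; have := koszul_eq 1 Up T01; have := koszul_eq 1 Up T11.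
rewrite !partial_constant !(partial_opp _ (e_differentiable Up)) !partial_e// (DT_sym 1 0 Up).
move: (h p (D 0 (T 0) p) (T 0 p)) (h p (D 0 (T 0) p) (T 1 p)).
move: (h p (D 0 (T 1) p) (T 0 p)) (h p (D 0 (T 1) p) (T 1 p)).
move: (h p (D 1 (T 1) p) (T 0 p)) (h p (D 1 (T 1) p) (T 1 p)).
move: (l 0 p) (l 1 p) (e p) => l0 l1 E c1 c2 c3 c4 c5 c6 e1 e2 e3 e4 e5 e6.
by split; [split|split]; lra.
Qed.

(** Differentiate the tangential coefficients h(D_1 T_1, T_0) and h(D_0 T_1,
    T_0), subtract, and replace the commutator by the ambient curvature.
    Products of two derivatives of the frame are expanded in the frame, which
    brings in the second fundamental form. *)
Lemma gauss_equation p : U p ->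
  partial 0 (l 0) p - partial 1 (l 1) p
  + (al p 0 1 ^+ 2 - be p 0 1 ^+ 2 - al p 0 0 * al p 0 2%:R + be p 0 0 * be p 0 2%:R)
  = - (L0 * e p).
Proof.
move=> Up.
have [[c000 c001 c010 c011] [c110 c111]] := tangential_coefficients Up.
have k0 : h p (D 0 (D 1 (T 1)) p) (T 0 p) + h p (D 1 (T 1) p) (D 0 (T 0) p)
    = partial 0 (fun q => l 0 q * e q) p.
  apply: partial_h_eq Up (DT_differentiable 1 1 Up) (T_differentiable 0 Up) => q Uq.
  by have [_ []] := tangential_coefficients Uq.
have k1 : h p (D 1 (D 0 (T 1)) p) (T 0 p) + h p (D 0 (T 1) p) (D 1 (T 0) p)
    = partial 1 (fun q => l 1 q * e q) p.
  apply: partial_h_eq Up (DT_differentiable 0 1 Up) (T_differentiable 0 Up) => q Uq.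
  by have [[]] := tangential_coefficients Uq.
have := curvature_tangent Up.
have := expansion (D 1 (T 1) p) (D 0 (T 0) p) Up.
have := expansion (D 0 (T 1) p) (D 0 (T 1) p) Up.
rewrite !sigma1// !sigma2// c000 c001 c010 c011 c110 c111.
move: k0 k1; rewrite (DT_sym 1 0 Up).
rewrite !(partial_mul _ (l_differentiable _ Up) (e_differentiable Up)) !partial_e//.
rewrite /sym_index /= (_ : 0%:R = 0 :> 'I_3)// (_ : 1%:R = 1 :> 'I_3)//.
have := e_neq0 p.
move: (h p (D 0 (D 1 (T 1)) p) (T 0 p)) (h p (D 1 (D 0 (T 1)) p) (T 0 p)) => x1 x2.
move: (h p (D 1 (T 1) p) (D 0 (T 0) p)) (h p (D 0 (T 1) p) (D 0 (T 1) p)) => x3 x4.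
move: (al p 0 0) (al p 0 1) (al p 0 2%:R) (be p 0 0) (be p 0 1) (be p 0 2%:R).
move: (partial 0 (l 0) p) (partial 1 (l 1) p) (l 0 p) (l 1 p) (e p).
move=> l00 l11 l0 l1 E a1 a2 a3 b1 b2 b3 E0 k0 k1 e1 e2 k2.
have X3 : x3 = E * (l0 ^+ 2 - l1 ^+ 2 + a1 * a3 - b1 * b3).
  by apply: (mulfI E0); rewrite e2; ring.
have X4 : x4 = E * (l1 ^+ 2 - l0 ^+ 2 + a2 ^+ 2 - b2 ^+ 2).
  by apply: (mulfI E0); rewrite e1; ring.
apply: (mulfI E0).
have -> : E * - (L0 * E) = x1 - x2 by rewrite k2; ring.
have -> : x1 = l00 * E + l0 * (2 * l0 * E) - x3 by rewrite -k0; ring.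
have -> : x2 = l11 * E + l1 * (2 * l1 * E) - x4 by rewrite -k1; ring.
by rewrite X3 X4; ring.
Qed.

(** The expansion of h v (D a (T b) p) in the frame has no tangential terms, so
    that only the coefficients of the second fundamental form are seen. *)
Lemma normal_second_form p v : U p -> (forall k, h p v (T k p) = 0) ->
  forall a b, h p v (D a (T b) p)
    = h p v (n1 p) * al p 0 (sym_index a b) + h p v (n2 p) * be p 0 (sym_index a b).
Proof.
move=> Up vT a b; apply: (mulfI (e_neq0 p)).
by rewrite expansion// !vT sigma1// sigma2//; ring.
Qed.

Lemma normal_connection1 p v : U p -> (forall k, h p v (T k p) = 0) ->
  forall k, h p v (D k n1 p) = l k p * h p v (n1 p) + mu k p * h p v (n2 p).
Proof.
move=> Up vT k; apply: (mulfI (e_neq0 p)).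
by rewrite expansion// !vT conn11// conn12//; ring.
Qed.

Lemma normal_connection2 p v : U p -> (forall k, h p v (T k p) = 0) ->
  forall k, h p v (D k n2 p) = mu k p * h p v (n1 p) + l k p * h p v (n2 p).
Proof.
move=> Up vT k; apply: (mulfI (e_neq0 p)).
by rewrite expansion// !vT conn21// conn22//; ring.
Qed.

Section NormalField.
Variable Y : 'rV[R]_2 -> V.
Hypothesis Y_differentiable : forall p, U p -> differentiable Y p.
Hypothesis YT : forall p, U p -> forall k, h p (Y p) (T k p) = 0.

Lemma normal_derivative_tangent p k b : U p ->
  h p (D k Y p) (T b p) = - h p (Y p) (D k (T b) p).
Proof.
move=> Up; apply/eqP; rewrite -addr_eq0.
by rewrite (partial_h_eq k (fun q Uq => YT Uq b)) ?partial_constant//;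
  [exact: Y_differentiable|exact: T_differentiable].
Qed.

(** Together with the two neighbouring lemmas this expresses the covariant
    derivative of a normal field, through its products with the frame, by the
    derivatives of its two coefficients. *)
Lemma normal_derivative1 p k : U p ->
  h p (D k Y p) (n1 p) = partial k (fun q => h q (Y q) (n1 q)) p
    - (l k p * h p (Y p) (n1 p) + mu k p * h p (Y p) (n2 p)).
Proof.
move=> Up; rewrite partial_h//; last 2 first.
- exact: Y_differentiable.
- exact: n1_differentiable.
by rewrite (normal_connection1 Up (YT Up)) addrK.
Qed.

Lemma normal_derivative2 p k : U p ->
  h p (D k Y p) (n2 p) = partial k (fun q => h q (Y q) (n2 q)) p
    - (mu k p * h p (Y p) (n1 p) + l k p * h p (Y p) (n2 p)).
Proof.
move=> Up; rewrite partial_h//; last 2 first.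
- exact: Y_differentiable.
- exact: n2_differentiable.
by rewrite (normal_connection2 Up (YT Up)) addrK.
Qed.

Hypothesis Y_dependent : forall p, U p -> forall j,
  h p (Y p) (n1 p) * al p 0 j + h p (Y p) (n2 p) * be p 0 j = 0.

Lemma dependent_second_form p a b : U p -> h p (D a (T b) p) (Y p) = 0.
Proof. by move=> Up; rewrite hC// (normal_second_form Up (YT Up)) Y_dependent. Qed.

Lemma dependent_derivative_tangent p k b : U p -> h p (D k Y p) (T b p) = 0.
Proof.
by move=> Up; rewrite normal_derivative_tangent// hC// dependent_second_form// oppr0.
Qed.

(** The function h(D_a T_b, Y) vanishes identically because Y annihilates the
    second fundamental form. Its derivatives in the two directions give h(D_0
    D_1 T_b, Y) and h(D_1 D_0 T_b, Y), which agree since the ambient curvature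
    has no normal component; so h(D_1 T_b, D_0 Y) = h(D_0 T_b, D_1 Y), and both
    are expanded in the frame. *)
Lemma codazzi_equation p b : U p ->
  al p 0 (sym_index 1 b) * h p (D 0 Y p) (n1 p)
  + be p 0 (sym_index 1 b) * h p (D 0 Y p) (n2 p)
  = al p 0 (sym_index 0 b) * h p (D 1 Y p) (n1 p)
    + be p 0 (sym_index 0 b) * h p (D 1 Y p) (n2 p).
Proof.
move=> Up.
have k0 := partial_h_eq 0 (fun q Uq => dependent_second_form 1 b Uq) Up
  (DT_differentiable 1 b Up) (Y_differentiable Up).
have k1 := partial_h_eq 1 (fun q Uq => dependent_second_form 0 b Uq) Up
  (DT_differentiable 0 b Up) (Y_differentiable Up).
have H := curvature_normal Up b (YT Up 0) (YT Up 1).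
have e0 := expansion (D 1 (T b) p) (D 0 Y p) Up.
have e1 := expansion (D 0 (T b) p) (D 1 Y p) Up.
move: k0 k1 e0 e1 H.
rewrite !partial_constant !dependent_derivative_tangent// !sigma1// !sigma2//.
move: (h p (D 0 (D 1 (T b)) p) (Y p)) (h p (D 1 (D 0 (T b)) p) (Y p)).
move: (h p (D 1 (T b) p) (D 0 Y p)) (h p (D 0 (T b) p) (D 1 Y p)).
move: (h p (D 0 Y p) (n1 p)) (h p (D 0 Y p) (n2 p)).
move: (h p (D 1 Y p) (n1 p)) (h p (D 1 Y p) (n2 p)).
move: (al p 0 _) (be p 0 _) (al p 0 _) (be p 0 _) (e p) (e_neq0 p).
move=> A1 B1 A0 B0 E E0 y11 y12 y01 y02 z1 z2 w1 w2 k0 k1 e0 e1 H.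
have z12 : z1 = z2 by lra.
apply: (mulfI E0).
by move: e0 e1; rewrite z12 => -> e1; move: e1; lra.
Qed.

End NormalField.

End MovingFrame.

(** * Adapted frames read in a chart *)

Lemma inner_combination (R : realType) n (g : 'M[R]_n) (s t : R) a b c :
  inner g (s *: a + t *: b) c = s * inner g a c + t * inner g b c.
Proof. by rewrite innerDl !innerZl. Qed.

Lemma orthogonal_plane_det (R : realType) n (h : 'rV[R]_n -> 'M[R]_n) y a b e :
  inner (h y) a a = e -> inner (h y) b b = - e -> inner (h y) a b = 0 ->
  plane_det h y a b = - e ^+ 2.
Proof. by rewrite /plane_det => -> -> ->; rewrite expr0n subr0 mulrN -expr2. Qed.

Section Charts.
Context {R : realType} (N : pseudoRiemannian R 4) (L0 : R).
Hypothesis N_curv : constant_curvature N L0.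
Variables (V : set 'rV[R]_2) (F : 'rV[R]_2 -> N) (lam : 'rV[R]_2 -> R).
Variables (N1 N2 : field N) (al be : 'rV[R]_2 -> 'rV[R]_3) (mu1 mu2 : 'rV[R]_2 -> R).
Hypothesis V_open : open V.
Hypothesis F_imm : timelike_conformal_immersion V F lam.
Hypothesis N12_frame : normal_frame V F lam N1 N2.
Hypothesis N12_sigma : second_form_coefficients V F lam N1 N2 al be.
Hypothesis N12_conn : normal_connection_coefficients V F lam N1 N2 mu1 mu2.

Definition connection_pair (k : 'I_2) := if k == 0 then mu1 else mu2.

Variable i : chart_index N.
Local Notation U := (V `&` F @^-1` chart_dom i).
Local Notation W := (chart i @` chart_dom i).
Local Notation x := (chart i \o F).
Local Notation h := (fun p => inner (metric i (chart i (F p)))).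

Lemma open_chart_preimage : open U.
Proof.
rewrite openE => p [Vp Fp]; have [[cF _] _ _] := F_imm.
apply: filterI; first exact: open_nbhs_nbhs.
apply: (cF p Vp); apply: open_nbhs_nbhs; split => //; exact: chart_dom_open.
Qed.

Lemma chart_image p : U p -> W (x p).
Proof. by move=> [_ Fp]; exists (F p). Qed.

Lemma eq_normal_part (g : 'rV[R]_2 -> 'M[R]_2) X Y p :
  X i p = Y i p -> normal_part F g X i p = normal_part F g Y i p.
Proof. by move=> XY; rewrite /normal_part /h_along XY. Qed.

Lemma normal_part_normal (g : 'rV[R]_2 -> 'M[R]_2) X (Y : 'rV[R]_4) p :
  (forall k, h p (tangent F k i p) Y = 0) ->
  h p (normal_part F g X i p) Y = h p (X i p) Y.
Proof.
move=> TY; rewrite /normal_part innerDl innerNl.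
rewrite (_ : inner _ (\sum_a _) Y = 0) ?subr0//.
rewrite /inner !mulmx_suml summxE big1// => a _.
rewrite !mulmx_suml summxE big1// => b _.
rewrite -!scalemxAl mxE -/(inner _ _ _) -[X in _ * X]/(inner _ _ _).
by rewrite TY mulr0.
Qed.

(** The two curvature identities are the value of the sectional curvature on the
    tangent plane, and its polarization in a normal direction. *)
Lemma chart_adapted_frame :
  adapted_frame U h (fun k => cov (metric i) x k) (fun k => tangent F k i)
    (N1 i) (N2 i) (fun p => expR (2 * lam p)) (fun k => partial k lam)
    connection_pair al be L0.
Proof.
have W_open := @chart_cod_open _ _ N i.
have G_smooth := @metric_smooth _ _ N i.
have G_sym := @Defs.metric_sym _ _ N i.
have G_unit := @metric_nondegenerate _ _ N i.
have U_open := open_chart_preimage.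
have xU := chart_image.
have [[cF sF] sl TT] := F_imm.
have sx := sF i.
have [[[sN1 _] [sN2 _]] [nN1 nN2] NN] := N12_frame.
have [_ _ sig] := N12_sigma.
have [_ _ con] := N12_conn.
have slU : smooth U lam by apply: subset_smooth sl => p [].
have hC p a b : U p -> h p a b = h p b a.
  by move=> Up; apply: innerC; exact: G_sym (xU p Up).
have NT1 p : U p -> forall k, h p (N1 i p) (tangent F k i p) = 0.
  by move=> [Vp Fp]; exact: nN1.
have NT2 p : U p -> forall k, h p (N2 i p) (tangent F k i p) = 0.
  by move=> [Vp Fp]; exact: nN2.
have TN1 p k : U p -> h p (tangent F k i p) (N1 i p) = 0.
  by move=> Up; rewrite hC// NT1.
have TN2 p k : U p -> h p (tangent F k i p) (N2 i p) = 0.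
  by move=> Up; rewrite hC// NT2.
have T00 p : U p -> h p (tangent F 0 i p) (tangent F 0 i p) = expR (2 * lam p).
  by move=> [Vp Fp]; apply: etrans (TT i p Vp Fp 0 0) _; rewrite lorentz_metricE /= expr0 mul1r.
have T11 p : U p -> h p (tangent F 1 i p) (tangent F 1 i p) = - expR (2 * lam p).
  by move=> [Vp Fp]; apply: etrans (TT i p Vp Fp 1 1) _; rewrite lorentz_metricE /= expr1 mulN1r.
have T01 p : U p -> h p (tangent F 0 i p) (tangent F 1 i p) = 0.
  by move=> [Vp Fp]; apply: etrans (TT i p Vp Fp 0 1) _; rewrite lorentz_metricE.
have E0 p : expR (2 * lam p) != 0 by rewrite gt_eqF ?expR_gt0.
have N11 p : U p -> h p (N1 i p) (N1 i p) = expR (2 * lam p).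
  by move=> [Vp Fp]; have [] := NN i p Vp Fp.
have N22 p : U p -> h p (N2 i p) (N2 i p) = - expR (2 * lam p).
  by move=> [Vp Fp]; have [] := NN i p Vp Fp.
have N12 p : U p -> h p (N1 i p) (N2 i p) = 0.
  by move=> [Vp Fp]; have [] := NN i p Vp Fp.
have dT k p : U p -> differentiable (tangent F k i) p.
  by move=> Up; exact: smooth_differentiable (smooth_partial k sx) Up.
have symT a b p : U p ->
    cov (metric i) x a (tangent F b i) p = cov (metric i) x b (tangent F a i) p.
  by move=> Up; exact: (cov_partial_sym W_open G_sym U_open sx xU a b Up).
have sigma a b p : U p -> normal_part F (lorentz_metric lam) (nabla F a (tangent F b)) i p
    = al p 0 (sym_index a b) *: N1 i p + be p 0 (sym_index a b) *: N2 i p.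
  move=> Up; have [Vp Fp] := Up; have [s00 s01 s11] := sig i p Vp Fp.
  elim/forall_ord2: a; elim/forall_ord2: b.
  - exact: s00.
  - exact: s01.
  - exact: (etrans (eq_normal_part _ (symT 1 0 p Up)) s01).
  - exact: s11.
have conn k p : U p ->
     normal_part F (lorentz_metric lam) (nabla F k N1) i p
     = partial k lam p *: N1 i p + connection_pair k p *: N2 i p
  /\ normal_part F (lorentz_metric lam) (nabla F k N2) i p
     = connection_pair k p *: N1 i p + partial k lam p *: N2 i p.
  move=> [Vp Fp]; have [c1 c2 c3 c4] := con i p Vp Fp.
  elim/forall_ord2: k; first exact: (conj c1 c2).
  exact: (conj c3 c4).
have comb1 p (a b : R) : U p ->
    h p (a *: N1 i p + b *: N2 i p) (N1 i p) = a * expR (2 * lam p).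
  move=> Up; rewrite inner_combination [X in a * X](N11 p Up).
  by rewrite (etrans (hC p (N2 i p) (N1 i p) Up) (N12 p Up)) mulr0 addr0.
have comb2 p (a b : R) : U p ->
    h p (a *: N1 i p + b *: N2 i p) (N2 i p) = - (b * expR (2 * lam p)).
  by move=> Up; rewrite inner_combination (N22 p Up) (N12 p Up) mulr0 add0r mulrN.
apply: AdaptedFrame.
- exact: U_open.
- exact: hC.
- move=> p a b Up; exact: (expansion4 a b (G_sym _ (xU p Up)) (E0 p) (T00 p Up) (T11 p Up)
    (N11 p Up) (N22 p Up) (T01 p Up) (TN1 p 0 Up) (TN2 p 0 Up) (TN1 p 1 Up) (TN2 p 1 Up)
    (N12 p Up)).
- exact: E0.
- by move=> p Up; exact: (differentiable_E slU Up).
- by move=> k p Up; exact: smooth_differentiable (smooth_partial k slU) Up.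
- by move=> k p Up; exact: (partial_E slU k Up).
- by move=> k X Y p Up dX dY;
    exact: (partial_inner W_open G_smooth G_sym G_unit sx xU k Up dX dY).
- exact: dT.
- by move=> a b p Up;
    exact: (differentiable_cov W_open G_smooth G_unit sx xU a Up (smooth_partial b sx)).
- by move=> p Up; exact: smooth_differentiable (sN1 i) Up.
- by move=> p Up; exact: smooth_differentiable (sN2 i) Up.
- exact: symT.
- exact: T00.
- exact: T11.
- exact: T01.
- move=> p Up a b; rewrite -(comb1 p _ (be p 0 (sym_index a b)) Up) -sigma//.
  by rewrite normal_part_normal// => k; exact: TN1.
- move=> p Up a b; rewrite -(comb2 p (al p 0 (sym_index a b)) _ Up) -sigma//.
  by rewrite normal_part_normal// => k; exact: TN2.
- move=> p Up k; have [c1 c2] := conn k p Up.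
  rewrite -(comb1 p _ (connection_pair k p) Up) -c1.
  by rewrite normal_part_normal// => b; exact: TN1.
- move=> p Up k; have [c1 c2] := conn k p Up.
  rewrite -(comb2 p (partial k lam p) _ Up) -c1.
  by rewrite normal_part_normal// => b; exact: TN2.
- move=> p Up k; have [c1 c2] := conn k p Up.
  rewrite -(comb1 p _ (partial k lam p) Up) -c2.
  by rewrite normal_part_normal// => b; exact: TN1.
- move=> p Up k; have [c1 c2] := conn k p Up.
  rewrite -(comb2 p (connection_pair k p) _ Up) -c2.
  by rewrite normal_part_normal// => b; exact: TN2.
- move=> p Up; have [_ Fp] := Up.
  rewrite -innerNl -innerDl (cov_commutator W_open G_smooth G_unit U_open sx xU 0 1 Up
    (smooth_partial 1 sx)).
  have pd : plane_det (metric i) (x p) (tangent F 0 i p) (tangent F 1 i p)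
      = - expR (2 * lam p) ^+ 2.
    exact: orthogonal_plane_det (T00 p Up) (T11 p Up) (T01 p Up).
  have pd0 : plane_det (metric i) (x p) (tangent F 0 i p) (tangent F 1 i p) != 0.
    by rewrite pd oppr_eq0 expf_neq0.
  apply: etrans (constant_curvature_sectional (@N_curv i _ Fp) pd0) _.
  by rewrite pd mulrN.
- move=> p Up b v v0 v1; have [_ Fp] := Up.
  have Tv k : h p (tangent F k i p) v = 0.
    by apply: etrans (hC p _ v Up) _; elim/forall_ord2: k.
  have T10 := etrans (hC p _ _ Up) (T01 p Up).
  have T0n : h p (tangent F 0 i p) (tangent F 0 i p) != 0 by rewrite (T00 p Up).
  have T1n : h p (tangent F 1 i p) (tangent F 1 i p) != 0 by rewrite (T11 p Up) oppr_eq0.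
  apply/eqP; rewrite -subr_eq0 -innerNl -innerDl; apply/eqP.
  rewrite (cov_commutator W_open G_smooth G_unit U_open sx xU 0 1 Up (smooth_partial b sx)).
  have ortho := constant_curvature_orthogonal W_open G_smooth G_sym G_unit (xU p Up)
    (@N_curv i _ Fp).
  elim/forall_ord2: b.
  - rewrite curvature_antisym innerNl; apply/eqP; rewrite oppr_eq0; apply/eqP.
    exact: (ortho _ _ _ T1n T0n T10 (Tv 1) (Tv 0)).
  - exact: (ortho _ _ _ T0n T1n (T01 p Up) (Tv 0) (Tv 1)).
Qed.

End Charts.

(** * Hyperbolic angles *)

Section Hyperbolic.
Context {R : realType} {m : nat}.
Implicit Types (c : causal) (t : 'rV[R]_m -> R) (s : R).

Definition causal_sign c : R := match c with spacelike => 1 | timelike => -1 end.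

(** The pair (hcos, hsin) is (cosh, sinh) in the space-like case and (sinh,
    cosh) in the time-like case. In both cases hcos and hsin are derivatives of
    each other and the difference of their squares is the causal sign, so the
    two cases are treated at once. *)
Definition hcos c s := match c with spacelike => cosh s | timelike => sinh s end.

Definition hsin c s := match c with spacelike => sinh s | timelike => cosh s end.

Lemma causal_sign_sqr c : causal_sign c * causal_sign c = 1.
Proof. by case: c; rewrite /= ?mulr1// mulrNN mulr1. Qed.

Lemma causal_sign_neq0 c : causal_sign c != 0.
Proof. by case: c; rewrite /= ?oppr_eq0 oner_eq0. Qed.

Lemma hcosE c s : hcos c s = (expR s + causal_sign c * expR (- s)) / 2.
Proof. by case: c => /=; rewrite ?mul1r ?mulN1r. Qed.

Lemma hsinE c s : hsin c s = (expR s - causal_sign c * expR (- s)) / 2.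
Proof. by case: c => /=; rewrite ?mul1r ?mulN1r ?opprK. Qed.

Lemma hcos_hsin_sqr c s : hcos c s ^+ 2 - hsin c s ^+ 2 = causal_sign c.
Proof.
have ee : expR s * expR (- s) = 1 by rewrite -expRD subrr expR0.
rewrite hcosE hsinE; transitivity (causal_sign c * (expR s * expR (- s))).
  by field.
by rewrite ee mulr1.
Qed.

Lemma differentiable_expRN t x : differentiable t x ->
  differentiable (fun y => expR (- t y)) x.
Proof. by move=> dt; apply: differentiable_expR; exact: differentiableN. Qed.

Lemma partial_expRN t x k : differentiable t x ->
  partial k (fun y => expR (- t y)) x = - partial k t x * expR (- t x).
Proof.
move=> dt; rewrite partial_expR; last exact: differentiableN.
by rewrite partial_opp.
Qed.

Lemma differentiable_ln (f : 'rV[R]_m -> R) x : differentiable f x -> 0 < f x ->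
  differentiable (fun y => ln (f y)) x.
Proof.
move=> df f0; apply: (@differentiable_comp _ _ _ _ f (@ln R)) => //.
by apply/derivable1_diffP; exact: (@ex_derive _ _ _ _ _ _ _ (is_derive1_ln f0)).
Qed.

Lemma partial_ln (f : 'rV[R]_m -> R) x k : differentiable f x -> 0 < f x ->
  partial k (fun y => ln (f y)) x = partial k f x / f x.
Proof. by move=> df f0; exact: (derive_real_comp _ df (is_derive1_ln f0)). Qed.

Lemma partial_cstM (b : R) (f : 'rV[R]_m -> R) x k : differentiable f x ->
  partial k (fun y => b * f y) x = b * partial k f x.
Proof. by move=> df; exact: (deriveZ b (diff_derivable df)). Qed.

Lemma partial_add (f g : 'rV[R]_m -> R) x k : differentiable f x -> differentiable g x ->
  partial k (fun y => f y + g y) x = partial k f x + partial k g x.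
Proof. by move=> df dg; exact: (deriveD (diff_derivable df) (diff_derivable dg)). Qed.

Lemma smooth_opp A (f : 'rV[R]_m -> R) : open A -> smooth A f -> smooth A (fun x => - f x).
Proof.
move=> oA sf; rewrite (_ : (fun x => - f x) = fun x => (-1) * f x).
  by apply: smooth_mul => //; exact: smooth_cst.
by apply/funext => x; rewrite mulN1r.
Qed.

Lemma smooth_hyperbolic A t (b : R) : open A -> smooth A t ->
  smooth A (fun x => (expR (t x) + b * expR (- t x)) / 2).
Proof.
move=> oA st; apply: smooth_mul => //; last exact: smooth_cst.
apply: smooth_add => //; first exact: smooth_expR.
apply: smooth_mul => //; first exact: smooth_cst.
by apply: smooth_expR => //; exact: smooth_opp.
Qed.

Lemma smooth_hcos c A t : open A -> smooth A t -> smooth A (fun x => hcos c (t x)).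
Proof. by move=> oA st; under eq_fun do rewrite hcosE; exact: smooth_hyperbolic. Qed.

Lemma smooth_hsin c A t : open A -> smooth A t -> smooth A (fun x => hsin c (t x)).
Proof.
by move=> oA st; under eq_fun do rewrite hsinE -mulNr; exact: smooth_hyperbolic.
Qed.

Lemma partial_hyperbolic t (b : R) x k : differentiable t x ->
  partial k (fun y => (expR (t y) + b * expR (- t y)) / 2) x
  = partial k t x * ((expR (t x) - b * expR (- t x)) / 2).
Proof.
move=> dt.
have d1 := differentiable_expR dt.
have d2 := differentiable_expRN dt.
have d3 : differentiable (fun y => b * expR (- t y)) x.
  by apply: differentiableM => //; exact: differentiable_cst.
have d4 : differentiable (fun y => expR (t y) + b * expR (- t y)) x by exact: differentiableD.
have -> : (fun y => (expR (t y) + b * expR (- t y)) / 2)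
    = fun y => 2^-1 * (expR (t y) + b * expR (- t y)) by apply/funext => y; rewrite mulrC.
rewrite (partial_cstM _ _ d4) (partial_add _ d1 d3) (partial_cstM _ _ d2).
by rewrite (partial_expR _ dt) (partial_expRN _ dt); field.
Qed.

Lemma partial_hcos c t x k : differentiable t x ->
  partial k (fun y => hcos c (t y)) x = partial k t x * hsin c (t x).
Proof.
by move=> dt; under [X in partial k X]eq_fun do rewrite hcosE; rewrite hsinE partial_hyperbolic.
Qed.

Lemma partial_hsin c t x k : differentiable t x ->
  partial k (fun y => hsin c (t y)) x = partial k t x * hcos c (t x).
Proof.
move=> dt; under [X in partial k X]eq_fun do rewrite hsinE -mulNr.
by rewrite hcosE partial_hyperbolic// mulNr opprK.
Qed.

Section Angle.
Variables (V : set 'rV[R]_m) (p q : 'rV[R]_m -> R) (mu : 'I_m -> 'rV[R]_m -> R).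
Hypotheses (V_open : open V) (V_connected : connected V).
Hypothesis p_differentiable : forall y, V y -> differentiable p y.
Hypothesis partial_p : forall y k, V y -> partial k p y = mu k y * p y.

(** The gradient of p exp (- t) vanishes. *)
Lemma exponential_solution t :
  (forall y, V y -> differentiable t y) ->
  (forall y k, V y -> partial k t y = mu k y) ->
  forall y0, V y0 -> forall y, V y -> p y = p y0 * expR (- t y0) * expR (t y).
Proof.
move=> dt pt y0 Vy0 y Vy.
have dpe z : V z -> differentiable (fun w => p w * expR (- t w)) z.
  move=> Vz; apply: differentiableM; first exact: p_differentiable.
  by apply: differentiable_expRN; exact: dt.
have := constant_of_partial0 V_open V_connected dpe _ Vy0 Vy => <-.
  by rewrite -mulrA -expRD addNr expR0 mulr1.
move=> z k Vz; rewrite (partial_mul k (p_differentiable Vz) (differentiable_expRN (dt z Vz))).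
by rewrite partial_expRN ?partial_p ?pt//; [ring|exact: dt].
Qed.

Hypothesis q_differentiable : forall y, V y -> differentiable q y.
Hypothesis partial_q : forall y k, V y -> partial k q y = - (mu k y * q y).
Variable c : causal.
Hypothesis pq_sign : forall y, V y -> 0 < causal_sign c * (p y * q y).

(** The angle is half of the logarithm of p / q up to sign, written as the
    quotient of p ^ 2 by the positive function causal_sign c * p * q. Since p q
    has zero gradient, the gradient of the angle is that of the logarithm of p. *)
Lemma angle_function :
  exists t, (forall y, V y -> differentiable t y /\ forall k, partial k t y = mu k y) /\
    forall y, V y -> q y = causal_sign c * p y * expR (- t y) * expR (- t y).
Proof.
(* Both arguments of the logarithms are positive, whatever the sign of p. *)
pose pp y := p y * p y; pose pq y := causal_sign c * (p y * q y).
exists (fun y => 2^-1 * ln (pp y) - 2^-1 * ln (pq y)).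
have p0 y : V y -> p y != 0.
  move=> Vy; apply: contraTneq (pq_sign Vy) => ->.
  by rewrite mul0r mulr0 ltxx.
have pp_gt0 y : V y -> 0 < pp y by move=> Vy; rewrite /pp -expr2 exprn_even_gt0// p0.
split=> y Vy.
  have dp := p_differentiable Vy; have dq := q_differentiable Vy.
  have dpp : differentiable pp y by exact: differentiableM.
  have dpq' : differentiable (fun y => p y * q y) y by exact: differentiableM.
  have dpq : differentiable pq y by apply: differentiableM => //; exact: differentiable_cst.
  have dlp := differentiable_ln dpp (pp_gt0 y Vy).
  have dlq := differentiable_ln dpq (pq_sign Vy).
  have d1 : differentiable (fun y => 2^-1 * ln (pp y)) y.
    by apply: differentiableM; [exact: differentiable_cst|exact: dlp].
  have d2 : differentiable (fun y => 2^-1 * ln (pq y)) y.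
    by apply: differentiableM; [exact: differentiable_cst|exact: dlq].
  split => [|k]; first exact: differentiableB.
  have -> : partial k (fun y => 2^-1 * ln (pp y) - 2^-1 * ln (pq y)) y
      = partial k (fun y => 2^-1 * ln (pp y)) y - partial k (fun y => 2^-1 * ln (pq y)) y.
    exact: (deriveB (diff_derivable d1) (diff_derivable d2)).
  rewrite (partial_cstM _ _ dlp) (partial_cstM _ _ dlq).
  rewrite (partial_ln k dpp (pp_gt0 y Vy)) (partial_ln k dpq (pq_sign Vy)).
  rewrite /pq (partial_cstM _ _ dpq') (partial_mul k dp dq).
  rewrite /pp (partial_mul k dp dp) partial_p// partial_q//.
  have -> : mu k y * p y * q y + p y * - (mu k y * q y) = 0 by ring.
  by rewrite mulr0 mul0r mulr0 subr0; move: (p y) (p0 y Vy) => P P0; field.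
rewrite -mulrA -expRD.
have -> : - (2^-1 * ln (pp y) - 2^-1 * ln (pq y)) + - (2^-1 * ln (pp y) - 2^-1 * ln (pq y))
    = ln (pq y) - ln (pp y) by field.
rewrite expRD expRN !lnK ?posrE ?pp_gt0//; last exact: pq_sign.
rewrite /pq /pp; transitivity ((causal_sign c * causal_sign c) * q y).
  by rewrite causal_sign_sqr mul1r.
by move: (p y) (p0 y Vy) => P P0; field.
Qed.

End Angle.
End Hyperbolic.

(** * Algebra of the linearly dependent condition *)

Lemma expansion_eq0 (R : comRingType) (a0 a1 a2 a3 b0 b1 b2 b3 : R) :
  a0 = 0 -> a1 = 0 -> a2 = 0 -> a3 = 0 ->
  a0 * b0 - a1 * b1 + a2 * b2 - a3 * b3 = 0.
Proof. by move=> -> -> -> ->; ring. Qed.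

(** Since (a_j, b_j) is orthogonal to (C, S), it is determined by r_j = S a_j +
    C b_j. The two equations read r2 t0 = r1 t1 and r3 t0 = r2 t1, and the
    determinant r1 r3 - r2 ^ 2 of this linear system is s times the quantity
    assumed nonzero. *)
Lemma codazzi_algebra (R : realFieldType) (a1 a2 a3 b1 b2 b3 C S w s t0 t1 : R) :
  w != 0 -> s != 0 -> C ^+ 2 - S ^+ 2 = s ->
  C * a1 + S * b1 = 0 -> C * a2 + S * b2 = 0 -> C * a3 + S * b3 = 0 ->
  a2 ^+ 2 - b2 ^+ 2 - a1 * a3 + b1 * b3 != 0 ->
  a2 * (w * S * t0) + b2 * (w * C * t0) = a1 * (w * S * t1) + b1 * (w * C * t1) ->
  a3 * (w * S * t0) + b3 * (w * C * t0) = a2 * (w * S * t1) + b2 * (w * C * t1) ->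
  t0 = 0 /\ t1 = 0.
Proof.
move=> w0 s0 CS d1 d2 d3 Q0 c0 c1.
pose r1 := S * a1 + C * b1; pose r2 := S * a2 + C * b2; pose r3 := S * a3 + C * b3.
have e0 : r2 * t0 = r1 * t1.
  by apply: (mulfI w0); rewrite /r1 /r2; move: c0; lra.
have e1 : r3 * t0 = r2 * t1.
  by apply: (mulfI w0); rewrite /r2 /r3; move: c1; lra.
have det : r1 * r3 - r2 ^+ 2 != 0.
  have -> : r1 * r3 - r2 ^+ 2 = s * (a2 ^+ 2 - b2 ^+ 2 - a1 * a3 + b1 * b3).
    transitivity ((C ^+ 2 - S ^+ 2) * (a2 ^+ 2 - b2 ^+ 2 - a1 * a3 + b1 * b3)
      + (C * a1 + S * b1) * (C * a3 + S * b3) - (C * a2 + S * b2) ^+ 2).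
      by rewrite /r1 /r2 /r3; ring.
    by rewrite CS d1 d2 d3; ring.
  by rewrite mulf_neq0.
split; apply: (mulfI det); rewrite mulr0 mulrBl.
- by rewrite -mulrA e1 expr2 -mulrA e0; ring.
- by rewrite mulrAC -[X in X * r3]e0 expr2 -[r2 * r2 * t1]mulrA -e1; ring.
Qed.

(** Reduces to the previous system: if (y1, y2) = w (C, S) varies with
    logarithmic derivative l of w and angular speed t, then subtracting the
    normal connection leaves w (t - m) (S, C). *)
Lemma codazzi_model_algebra (R : realFieldType)
    (a1 a2 a3 b1 b2 b3 C S w s l0 l1 m0 m1 t0 t1 y1 y2 d01 d02 d11 d12 : R) :
  w != 0 -> s != 0 -> C ^+ 2 - S ^+ 2 = s ->
  C * a1 + S * b1 = 0 -> C * a2 + S * b2 = 0 -> C * a3 + S * b3 = 0 ->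
  a2 ^+ 2 - b2 ^+ 2 - a1 * a3 + b1 * b3 != 0 ->
  y1 = w * C -> y2 = w * S ->
  d01 = l0 * y1 + t0 * y2 -> d02 = l0 * y2 + t0 * y1 ->
  d11 = l1 * y1 + t1 * y2 -> d12 = l1 * y2 + t1 * y1 ->
  a2 * (d01 - (l0 * y1 + m0 * y2)) + b2 * (d02 - (m0 * y1 + l0 * y2))
    = a1 * (d11 - (l1 * y1 + m1 * y2)) + b1 * (d12 - (m1 * y1 + l1 * y2)) ->
  a3 * (d01 - (l0 * y1 + m0 * y2)) + b3 * (d02 - (m0 * y1 + l0 * y2))
    = a2 * (d11 - (l1 * y1 + m1 * y2)) + b2 * (d12 - (m1 * y1 + l1 * y2)) ->
  t0 = m0 /\ t1 = m1.
Proof.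
move=> w0 s0 CS e1 e2 e3 Q0 -> -> -> -> -> -> c0 c1.
have f1 l t m : l * (w * C) + t * (w * S) - (l * (w * C) + m * (w * S)) = w * S * (t - m).
  by ring.
have f2 l t m : l * (w * S) + t * (w * C) - (m * (w * C) + l * (w * S)) = w * C * (t - m).
  by ring.
rewrite !f1 !f2 in c0 c1.
have [/eqP h0 /eqP h1] := codazzi_algebra w0 s0 CS e1 e2 e3 Q0 c0 c1.
by split; apply/eqP; rewrite -subr_eq0.
Qed.

(** * Normal fields of the surface *)

Section Restriction.
Context {R : realType} (N : pseudoRiemannian R 4).
Variables (V D : set 'rV[R]_2) (F : 'rV[R]_2 -> N) (lam : 'rV[R]_2 -> R).
Variables (N1 N2 : field N) (al be : 'rV[R]_2 -> 'rV[R]_3) (mu1 mu2 : 'rV[R]_2 -> R).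
Hypothesis VD : V `<=` D.

Lemma subset_in_charts (P : chart_index N -> 'rV[R]_2 -> Prop) :
  in_charts D F P -> in_charts V F P.
Proof. by move=> DP i p /VD; exact: DP. Qed.

Lemma subset_field_along (X : field N) : field_along D F X -> field_along V F X.
Proof.
move=> [sX tX]; split => [i|i j p /VD]; last exact: tX.
by apply: subset_smooth (sX i) => p [/VD].
Qed.

Lemma subset_immersion :
  timelike_conformal_immersion D F lam -> timelike_conformal_immersion V F lam.
Proof.
move=> [[cF sF] sl TT]; split; last exact: subset_in_charts.
- split => [p /VD|i]; first exact: cF.
  by apply: subset_smooth (sF i) => p [/VD].
- exact: subset_smooth sl.
Qed.

Lemma subset_normal_frame : normal_frame D F lam N1 N2 -> normal_frame V F lam N1 N2.
Proof.
move=> [[f1 f2] [m1 m2] NN].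
by split; [split; exact: subset_field_along|split; exact: subset_in_charts
  |exact: subset_in_charts].
Qed.

Lemma subset_second_form : second_form_coefficients D F lam N1 N2 al be ->
  second_form_coefficients V F lam N1 N2 al be.
Proof. by move=> [sa sb ss]; split; [exact: subset_smooth sa|exact: subset_smooth sb
  |exact: subset_in_charts]. Qed.

Lemma subset_connection : normal_connection_coefficients D F lam N1 N2 mu1 mu2 ->
  normal_connection_coefficients V F lam N1 N2 mu1 mu2.
Proof. by move=> [sa sb ss]; split; [exact: subset_smooth sa|exact: subset_smooth sb
  |exact: subset_in_charts]. Qed.

End Restriction.

Lemma normal_square (R : comRingType) (a b c d z : R) :
  a = 0 -> b = 0 -> z = a * a - b * b + c * c - d * d -> z = c ^+ 2 - d ^+ 2.
Proof. by move=> -> -> ->; ring. Qed.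

Lemma combination_congr (R : comRingType) (a b c d x y z w x' y' z' w' : R) :
  x = x' -> y = y' -> z = z' -> w = w' -> a * x + b * y = c * z + d * w ->
  a * x' + b * y' = c * z' + d * w'.
Proof. by move=> -> -> -> ->. Qed.

Section Surfaces.
Context {R : realType} (N : pseudoRiemannian R 4) (L0 : R).
Hypothesis N_curv : constant_curvature N L0.
Variables (V : set 'rV[R]_2) (F : 'rV[R]_2 -> N) (lam : 'rV[R]_2 -> R).
Variables (N1 N2 : field N) (al be : 'rV[R]_2 -> 'rV[R]_3) (mu1 mu2 : 'rV[R]_2 -> R).
Hypothesis V_open : open V.
Hypothesis F_imm : timelike_conformal_immersion V F lam.
Hypothesis N12_frame : normal_frame V F lam N1 N2.
Hypothesis N12_sigma : second_form_coefficients V F lam N1 N2 al be.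
Hypothesis N12_conn : normal_connection_coefficients V F lam N1 N2 mu1 mu2.

Local Notation mu := (connection_pair mu1 mu2).
Local Notation E p := (expR (2 * lam p)).
Local Notation frame i := (chart_adapted_frame N_curv V_open F_imm N12_frame N12_sigma N12_conn i).
Local Notation U i := (V `&` F @^-1` chart_dom i).

Lemma sym_index_surj (j : 'I_3) : exists a b, sym_index a b = j.
Proof.
case: j => [[|[|[|//]]] Hj].
- by exists 0, 0; exact: val_inj.
- by exists 0, 1; exact: val_inj.
- by exists 1, 1; exact: val_inj.
Qed.

(** The Gauss equation, in which the wave operator applied to lam is replaced by
    the curvature of the induced metric. *)
Lemma gauss_relation p : V p ->
  (gauss_curvature (lorentz_metric lam) p - L0) * E p
  = al p 0 1 ^+ 2 - be p 0 1 ^+ 2 - al p 0 0 * al p 0 2%:R + be p 0 0 * be p 0 2%:R.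
Proof.
move=> Vp; have [i Fp] := @chart_cover _ _ N (F p).
have slam : smooth V lam by have [] := F_imm.
have := gauss_equation (frame i) (conj Vp Fp).
rewrite (gauss_curvature_lorentz V_open slam Vp).
have : E p != 0 by rewrite gt_eqF ?expR_gt0.
move: (partial 0 (partial 0 lam) p) (partial 1 (partial 1 lam) p) => l00 l11.
move: (E p) => e; set Q := (_ + be p 0 0 * _); clearbody Q => e0 H.
have -> : Q = - (L0 * e) - (l00 - l11) by rewrite -H; ring.
by field.
Qed.

Definition some_chart (p : 'rV[R]_2) : chart_index N := sval (cid (@chart_cover _ _ N (F p))).

Lemma some_chartP p : chart_dom (some_chart p) (F p).
Proof. exact: (svalP (cid (@chart_cover _ _ N (F p)))). Qed.

(** The components of a field are given chart by chart, but inner products are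
    functions on the surface; any choice of charts gives the same values for
    fields along F. *)
Definition product (X Y : field N) p : R := h_along F X Y (some_chart p) p.

Section NormalFields.
Variable xi : field N.
Hypothesis xi_field : field_along V F xi.
Hypothesis xi_normal : normal V F xi.

(** The differential of a change of charts is an isometry and relates the
    components of the fields. *)
Lemma productE (X Y : field N) i p : field_along V F X -> field_along V F Y ->
  V p -> chart_dom i (F p) -> product X Y p = h_along F X Y i p.
Proof.
move=> [_ tX] [_ tY] Vp Fp; have Fs := some_chartP p.
rewrite /product /h_along (metric_transition Fs Fp).
by rewrite (tX _ _ _ Vp Fs Fp) (tY _ _ _ Vp Fs Fp).
Qed.

Lemma field_differentiable (X : field N) i p : field_along V F X -> U i p ->
  differentiable (X i) p.
Proof. by move=> [sX _] Up; exact: smooth_differentiable (sX i) Up. Qed.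

Lemma local_product (X Y : field N) i p : field_along V F X -> field_along V F Y -> U i p ->
  [/\ differentiable (product X Y) p &
      forall k, partial k (product X Y) p = partial k (h_along F X Y i) p].
Proof.
move=> fX fY Up; have oU := open_chart_preimage V_open F_imm (i := i).
have E0 q : U i q -> h_along F X Y i q = product X Y q.
  by move=> [Vq Fq]; rewrite (productE fX fY Vq Fq).
split => [|k]; last by apply: esym; exact: eq_partial oU Up E0.
apply: (eq_differentiable oU Up E0).
have [[_ sF] _ _] := F_imm.
apply: (differentiable_inner (@metric_smooth _ _ N i) (sF i) (@chart_image _ _ _ _ i) Up).
  exact: field_differentiable fX Up.
exact: field_differentiable fY Up.
Qed.

Lemma N1_field : field_along V F N1. Proof. by have [[]] := N12_frame. Qed.

Lemma N2_field : field_along V F N2. Proof. by have [[]] := N12_frame. Qed.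

Local Notation y1 := (product xi N1).
Local Notation y2 := (product xi N2).

Lemma xi_orthogonal i p : U i p -> forall k,
  inner (metric i (chart i (F p))) (xi i p) (tangent F k i p) = 0.
Proof. by move=> [Vp Fp]; exact: xi_normal. Qed.

Lemma nabla_N1 i p k : U i p ->
  h_along F (nabla F k xi) N1 i p = partial k y1 p - (partial k lam p * y1 p + mu k p * y2 p).
Proof.
move=> Up; have [Vp Fp] := Up.
have [_ ->] := local_product xi_field N1_field Up.
rewrite (productE xi_field N1_field Vp Fp) (productE xi_field N2_field Vp Fp).
exact: (normal_derivative1 (frame i) (fun q => field_differentiable xi_field)
  (@xi_orthogonal i) k Up).
Qed.

Lemma nabla_N2 i p k : U i p ->
  h_along F (nabla F k xi) N2 i p = partial k y2 p - (mu k p * y1 p + partial k lam p * y2 p).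
Proof.
move=> Up; have [Vp Fp] := Up.
have [_ ->] := local_product xi_field N2_field Up.
rewrite (productE xi_field N1_field Vp Fp) (productE xi_field N2_field Vp Fp).
exact: (normal_derivative2 (frame i) (fun q => field_differentiable xi_field)
  (@xi_orthogonal i) k Up).
Qed.

Lemma nabla_T i p k b : U i p ->
  h_along F (nabla F k xi) (tangent F b) i p
  = - (y1 p * al p 0 (sym_index k b) + y2 p * be p 0 (sym_index k b)).
Proof.
move=> Up; have [Vp Fp] := Up.
rewrite (productE xi_field N1_field Vp Fp) (productE xi_field N2_field Vp Fp).
rewrite -(normal_second_form (frame i) Up (xi_orthogonal Up)).
exact: (normal_derivative_tangent (frame i) (fun q => field_differentiable xi_field)
  (@xi_orthogonal i) k b Up).
Qed.

Lemma product_self i p : U i p -> E p * h_along F xi xi i p = y1 p ^+ 2 - y2 p ^+ 2.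
Proof.
move=> Up; have [Vp Fp] := Up.
rewrite (productE xi_field N1_field Vp Fp) (productE xi_field N2_field Vp Fp).
exact: normal_square (xi_orthogonal Up 0) (xi_orthogonal Up 1)
  (frame_expansion (frame i) (xi i p) (xi i p) Up).
Qed.

(** The hypothesis says that xi is orthogonal to the second fundamental form on
    V. *)
Lemma codazzi_relation p b :
  (forall q, V q -> forall j, y1 q * al q 0 j + y2 q * be q 0 j = 0) -> V p ->
  al p 0 (sym_index 1 b) * (partial 0 y1 p - (partial 0 lam p * y1 p + mu 0 p * y2 p))
  + be p 0 (sym_index 1 b) * (partial 0 y2 p - (mu 0 p * y1 p + partial 0 lam p * y2 p))
  = al p 0 (sym_index 0 b) * (partial 1 y1 p - (partial 1 lam p * y1 p + mu 1 p * y2 p))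
  + be p 0 (sym_index 0 b) * (partial 1 y2 p - (mu 1 p * y1 p + partial 1 lam p * y2 p)).
Proof.
move=> dep Vp; have Fp := some_chartP p; set i := some_chart p in Fp.
have Up : U i p by split.
have depU q : U i q -> forall j,
    h_along F xi N1 i q * al q 0 j + h_along F xi N2 i q * be q 0 j = 0.
  move=> [Vq Fq] j; have := dep q Vq j.
  by rewrite (productE xi_field N1_field Vq Fq) (productE xi_field N2_field Vq Fq).
have cod := codazzi_equation (frame i) (fun q => field_differentiable xi_field)
  (@xi_orthogonal i) depU b Up.
exact: combination_congr (nabla_N1 0 Up) (nabla_N2 0 Up) (nabla_N1 1 Up) (nabla_N2 1 Up) cod.
Qed.

End NormalFields.

(** * The model fields *)

(** By the expansion in the frame, a is orthogonal to every vector, and the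
    metric is nondegenerate. *)
Lemma frame_eq0 i p a : U i p ->
  inner (metric i (chart i (F p))) a (tangent F 0 i p) = 0 ->
  inner (metric i (chart i (F p))) a (tangent F 1 i p) = 0 ->
  inner (metric i (chart i (F p))) a (N1 i p) = 0 ->
  inner (metric i (chart i (F p))) a (N2 i p) = 0 -> a = 0.
Proof.
move=> Up a0 a1 a2 a3; have [Vp Fp] := Up.
have unitG : metric i (chart i (F p)) \in unitmx.
  by apply: metric_nondegenerate; exists (F p).
have ab b : inner (metric i (chart i (F p))) a b = 0.
  apply: (mulfI (frame_e_neq0 (frame i) p)); rewrite mulr0.
  apply: etrans (frame_expansion (frame i) a b Up) _.
  exact: expansion_eq0 a0 a1 a2 a3.
rewrite -[a](mulmxK unitG) (_ : a *m _ = 0) ?mul0mx//.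
apply/rowP => j; have := ab (delta_mx 0 j).
by rewrite /inner trmx_delta -colE !mxE.
Qed.

Section Model.
Variables (c : causal) (t : 'rV[R]_2 -> R).
Hypothesis t_smooth : smooth V t.

Local Notation X := (parallel_model c lam N1 N2 t).

Lemma modelE i p : X i p
  = expR (- lam p) *: (hcos c (t p) *: N1 i p + (- hsin c (t p)) *: N2 i p).
Proof. by rewrite /parallel_model scaleNr; case: c. Qed.

Lemma model_field : field_along V F X.
Proof.
have [sN1 tN1] := N1_field; have [sN2 tN2] := N2_field.
have [_ slam _] := F_imm.
split => [i|i j p Vp Fi Fj].
  have oU := open_chart_preimage V_open F_imm (i := i).
  rewrite (_ : X i = fun p =>
    expR (- lam p) *: (hcos c (t p) *: N1 i p + (- hsin c (t p)) *: N2 i p)); last first.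
    by apply/funext => p; exact: modelE.
  have stU : smooth (U i) t by apply: subset_smooth t_smooth => q [].
  have slU : smooth (U i) lam by apply: subset_smooth slam => q [].
  apply: (smooth_scale oU); first exact: (smooth_expR oU (smooth_opp oU slU)).
  apply: (smooth_add oU); apply: (smooth_scale oU) => //.
    exact: (smooth_hcos c oU stU).
  exact: (smooth_opp oU (smooth_hsin c oU stU)).
have dtr : differentiable (chart j \o param i) (chart i (F p)).
  by apply: smooth_differentiable (@transition_smooth _ _ N i j) _; exists (F p).
rewrite !modelE (deriveZr _ _ dtr) (deriveDr _ _ dtr) !(deriveZr _ _ dtr).
by rewrite -(tN1 i j p Vp Fi Fj) -(tN2 i j p Vp Fi Fj).
Qed.

Lemma model_normal : normal V F X.
Proof.
have [_ [m1 m2] _] := N12_frame.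
move=> i p Vp Fp k; rewrite /h_along modelE innerZl inner_combination.
rewrite -![inner _ _ (tangent F k i p)]/(h_along F _ (tangent F k) i p).
by rewrite (m1 i p Vp Fp k) (m2 i p Vp Fp k) !mulr0 addr0 mulr0.
Qed.

Lemma expR_lam p : expR (- lam p) * E p = expR (lam p).
Proof. by rewrite -expRD; congr expR; ring. Qed.

Lemma model_N1 i p : U i p -> h_along F X N1 i p = expR (lam p) * hcos c (t p).
Proof.
move=> Up; have [Vp Fp] := Up; have [_ _ NN] := N12_frame.
have [n11 _ n12] := NN i p Vp Fp.
have n21 := etrans (frame_hC (frame i) (N2 i p) (N1 i p) Up) n12.
rewrite /h_along modelE innerZl inner_combination.
apply: etrans (f_equal2 (fun u v => expR (- lam p) * (hcos c (t p) * u + - hsin c (t p) * v))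
  n11 n21) _.
by rewrite -(expR_lam p); ring.
Qed.

Lemma model_N2 i p : U i p -> h_along F X N2 i p = expR (lam p) * hsin c (t p).
Proof.
move=> Up; have [Vp Fp] := Up; have [_ _ NN] := N12_frame.
have [_ n22 n12] := NN i p Vp Fp.
rewrite /h_along modelE innerZl inner_combination.
apply: etrans (f_equal2 (fun u v => expR (- lam p) * (hcos c (t p) * u + - hsin c (t p) * v))
  n12 n22) _.
by rewrite -(expR_lam p); ring.
Qed.

Lemma product_model_N1 p : V p -> product X N1 p = expR (lam p) * hcos c (t p).
Proof. by move=> Vp; apply: model_N1; split => //; exact: some_chartP. Qed.

Lemma product_model_N2 p : V p -> product X N2 p = expR (lam p) * hsin c (t p).
Proof. by move=> Vp; apply: model_N2; split => //; exact: some_chartP. Qed.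

Lemma lam_differentiable p : V p -> differentiable lam p.
Proof. by move=> Vp; have [_ slam _] := F_imm; exact: smooth_differentiable slam Vp. Qed.

Lemma partial_product_model p k : V p ->
  partial k (product X N1) p
    = partial k lam p * product X N1 p + partial k t p * product X N2 p /\
  partial k (product X N2) p
    = partial k lam p * product X N2 p + partial k t p * product X N1 p.
Proof.
move=> Vp; have dt := smooth_differentiable t_smooth Vp.
have dl := lam_differentiable Vp; have de := differentiable_expR dl.
have dc : differentiable (fun q => hcos c (t q)) p.
  exact: smooth_differentiable (smooth_hcos c V_open t_smooth) Vp.
have ds : differentiable (fun q => hsin c (t q)) p.
  exact: smooth_differentiable (smooth_hsin c V_open t_smooth) Vp.
rewrite (eq_partial k V_open Vp product_model_N1) (eq_partial k V_open Vp product_model_N2).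
rewrite (partial_mul k de dc) (partial_mul k de ds) (partial_expR k dl).
rewrite (partial_hcos c k dt) (partial_hsin c k dt).
rewrite product_model_N1// product_model_N2//.
by split; ring.
Qed.

Hypothesis t_dependent : forall p, V p -> forall j,
  hcos c (t p) * al p 0 j + hsin c (t p) * be p 0 j = 0.

Lemma product_model_dependent p j : V p ->
  product X N1 p * al p 0 j + product X N2 p * be p 0 j = 0.
Proof.
move=> Vp; rewrite product_model_N1// product_model_N2// -!mulrA -mulrDr.
by rewrite t_dependent// mulr0.
Qed.

(** The model field with angle t is orthogonal to the second fundamental form,
    and its covariant derivative is (d_k t - mu_k) times the other unit normal.
    The Codazzi equations are then a linear system for d_k t - mu_k, whose
    determinant is nonzero by the Gauss equation because K differs from L0. *)
Lemma dependent_partial p : V p ->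
  gauss_curvature (lorentz_metric lam) p != L0 ->
  forall k, partial k t p = mu k p.
Proof.
move=> Vp KL.
have Q0 : al p 0 1 ^+ 2 - be p 0 1 ^+ 2 - al p 0 0 * al p 0 2%:R + be p 0 0 * be p 0 2%:R != 0.
  by rewrite -gauss_relation// mulf_neq0 ?subr_eq0// gt_eqF ?expR_gt0.
have dep q (Vq : V q) j := product_model_dependent j Vq.
have c0 := codazzi_relation model_field model_normal 0 dep Vp.
have c1 := codazzi_relation model_field model_normal 1 dep Vp.
have [p01 p02] := partial_product_model 0 Vp.
have [p11 p12] := partial_product_model 1 Vp.
have w0 : expR (lam p) != 0 by rewrite gt_eqF ?expR_gt0.
have [t0 t1] := codazzi_model_algebra w0 (causal_sign_neq0 c) (hcos_hsin_sqr c (t p))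
  (t_dependent Vp 0) (t_dependent Vp 1) (t_dependent Vp 2%:R) Q0
  (product_model_N1 Vp) (product_model_N2 Vp) p01 p02 p11 p12 c0 c1.
by elim/forall_ord2.
Qed.

(** All four products of the derivative of the model with the frame vanish:
    those with the tangent vectors by linear dependence, those with N1 and N2
    because t has the gradient mu. *)
Lemma model_parallel : (forall p, V p -> forall k, partial k t p = mu k p) ->
  parallel_normal_of c V F X.
Proof.
move=> pt.
have self i p : U i p -> h_along F X X i p = causal_sign c.
  move=> Up; have [Vp Fp] := Up.
  have E0 : E p != 0 by rewrite gt_eqF ?expR_gt0.
  apply: (mulfI E0); rewrite (product_self model_field model_normal Up).
  rewrite product_model_N1// product_model_N2// -(hcos_hsin_sqr c (t p)).
  have -> : E p = expR (lam p) ^+ 2 by rewrite expr2 -expRD; congr expR; ring.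
  ring.
split; last first.
  by move=> i p Vp Fp; case: c (self i p (conj Vp Fp)) => /= ->; rewrite ?ltr01 ?ltrN10.
split => //.
- exact: model_field.
- exact: model_normal.
- move=> i p Vp Fp; apply/eqP => X0; have := self i p (conj Vp Fp).
  rewrite /h_along X0 inner0l => /esym/eqP.
  by rewrite (negbTE (causal_sign_neq0 c)).
- move=> i p Vp Fp k; have Up : U i p by [].
  have nT b : h_along F (nabla F k X) (tangent F b) i p = 0.
    by rewrite (nabla_T model_field model_normal k b Up) product_model_dependent// oppr0.
  apply: (frame_eq0 Up (nT 0) (nT 1)).
  + apply: etrans (nabla_N1 model_field model_normal k Up) _.
    have [-> _] := partial_product_model k Vp.
    by rewrite (pt p Vp k) subrr.
  + apply: etrans (nabla_N2 model_field model_normal k Up) _.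
    have [_ ->] := partial_product_model k Vp.
    by rewrite (pt p Vp k) [X in X - _]addrC subrr.
Qed.

End Model.

(** * Parallel normal fields *)

Section ParallelFields.
Variables (c : causal) (xi : field N).
Hypothesis V_connected : connected V.
Variable base : 'rV[R]_2.
Hypothesis V_base : V base.
Hypothesis xi_parallel : parallel_normal_of c V F xi.

Local Notation y1 := (product xi N1).
Local Notation y2 := (product xi N2).

Lemma parallel_field : field_along V F xi. Proof. by have [[]] := xi_parallel. Qed.

Lemma parallel_is_normal : normal V F xi. Proof. by have [[]] := xi_parallel. Qed.

Lemma parallel_nabla (Y : field N) k p : V p -> h_along F (nabla F k xi) Y (some_chart p) p = 0.
Proof.
move=> Vp; have [[_ _ _ flat] _] := xi_parallel.
by rewrite /h_along (flat _ p Vp (some_chartP p) k) inner0l.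
Qed.

Lemma parallel_partial p k : V p ->
  partial k y1 p = partial k lam p * y1 p + mu k p * y2 p /\
  partial k y2 p = mu k p * y1 p + partial k lam p * y2 p.
Proof.
move=> Vp; have Up : U (some_chart p) p by split => //; exact: some_chartP.
have e1 := nabla_N1 parallel_field parallel_is_normal k Up.
have e2 := nabla_N2 parallel_field parallel_is_normal k Up.
split; apply/eqP; rewrite -subr_eq0; apply/eqP.
  exact: etrans (esym e1) (parallel_nabla N1 k Vp).
exact: etrans (esym e2) (parallel_nabla N2 k Vp).
Qed.

Lemma parallel_dependent p j : V p -> y1 p * al p 0 j + y2 p * be p 0 j = 0.
Proof.
move=> Vp; have Up : U (some_chart p) p by split => //; exact: some_chartP.
have [a [b <-]] := sym_index_surj j.
have e1 := nabla_T parallel_field parallel_is_normal a b Up.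
by apply/eqP; rewrite -oppr_eq0 -e1; apply/eqP; exact: parallel_nabla.
Qed.

Lemma parallel_causal p : V p -> 0 < causal_sign c * (y1 p ^+ 2 - y2 p ^+ 2).
Proof.
move=> Vp; have Fp := some_chartP p; have [_ cau] := xi_parallel.
rewrite -(product_self parallel_field parallel_is_normal (conj Vp Fp)).
rewrite mulrCA mulr_gt0 ?expR_gt0//.
have := cau _ p Vp Fp; case: c => /=; first by rewrite mul1r.
by rewrite mulN1r oppr_gt0.
Qed.

Lemma product_differentiable p : V p -> differentiable y1 p /\ differentiable y2 p.
Proof.
move=> Vp; have Up : U (some_chart p) p by split => //; exact: some_chartP.
have [d1 _] := local_product parallel_field N1_field Up.
by have [d2 _] := local_product parallel_field N2_field Up.
Qed.

(** In the null coordinates y1 + y2 and y1 - y2 the normal connection is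
    diagonal, and the factor exp (- lam) removes its part that comes from the
    scaling of N1 and N2. *)
Definition light_plus p := expR (- lam p) * (y1 p + y2 p).

Definition light_minus p := expR (- lam p) * (y1 p - y2 p).

Lemma expRN_lam_differentiable p : V p -> differentiable (fun q => expR (- lam q)) p.
Proof. by move=> Vp; apply: differentiable_expRN; exact: lam_differentiable. Qed.

Lemma light_differentiable p : V p ->
  differentiable light_plus p /\ differentiable light_minus p.
Proof.
move=> Vp; have [d1 d2] := product_differentiable Vp; have de := expRN_lam_differentiable Vp.
by split; apply: differentiableM => //; [exact: differentiableD|exact: differentiableB].
Qed.

Lemma light_partial p k : V p ->
  partial k light_plus p = mu k p * light_plus p /\
  partial k light_minus p = - (mu k p * light_minus p).
Proof.
move=> Vp; have [d1 d2] := product_differentiable Vp; have de := expRN_lam_differentiable Vp.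
have dl := lam_differentiable Vp; have [p1 p2] := parallel_partial k Vp.
have e1 : partial k (fun q => y1 q + y2 q) p = partial k y1 p + partial k y2 p.
  exact: partial_add.
have e2 : partial k (fun q => y1 q - y2 q) p = partial k y1 p - partial k y2 p.
  exact: (deriveB (diff_derivable d1) (diff_derivable d2)).
have m1 : partial k light_plus p = partial k (fun q => expR (- lam q)) p * (y1 p + y2 p)
    + expR (- lam p) * partial k (fun q => y1 q + y2 q) p.
  exact: (partial_mul k de (differentiableD d1 d2)).
have m2 : partial k light_minus p = partial k (fun q => expR (- lam q)) p * (y1 p - y2 p)
    + expR (- lam p) * partial k (fun q => y1 q - y2 q) p.
  exact: (partial_mul k de (differentiableB d1 d2)).
split.
  by rewrite m1 (partial_expRN k dl) e1 p1 p2 /light_plus; ring.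
by rewrite m2 (partial_expRN k dl) e2 p1 p2 /light_minus; ring.
Qed.

Lemma light_sign p : V p -> 0 < causal_sign c * (light_plus p * light_minus p).
Proof.
move=> Vp; rewrite /light_plus /light_minus.
have -> : causal_sign c * (expR (- lam p) * (y1 p + y2 p) * (expR (- lam p) * (y1 p - y2 p)))
    = expR (- lam p) * expR (- lam p) * (causal_sign c * (y1 p ^+ 2 - y2 p ^+ 2)) by ring.
apply: mulr_gt0; last exact: parallel_causal.
by rewrite mulr_gt0 ?expR_gt0.
Qed.

Lemma light_plus_neq0 p : V p -> light_plus p != 0.
Proof.
by move=> Vp; apply: contraTneq (light_sign Vp) => ->; rewrite mul0r mulr0 ltxx.
Qed.

Lemma product_light p :
  y1 p = expR (lam p) * ((light_plus p + light_minus p) / 2) /\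
  y2 p = expR (lam p) * ((light_plus p - light_minus p) / 2).
Proof.
have ee : expR (lam p) * expR (- lam p) = 1 by rewrite -expRD subrr expR0.
split.
  transitivity ((expR (lam p) * expR (- lam p)) * y1 p); first by rewrite ee mul1r.
  by rewrite /light_plus /light_minus; field.
transitivity ((expR (lam p) * expR (- lam p)) * y2 p); first by rewrite ee mul1r.
by rewrite /light_plus /light_minus; field.
Qed.

(** The constant of proportionality r is the value of light_plus times exp (-
    t), which does not depend on the point. *)
Lemma proportional_to_model t : smooth V t ->
  (forall p, V p -> forall k, partial k t p = mu k p) ->
  (forall p, V p -> light_minus p
     = causal_sign c * light_plus p * expR (- t p) * expR (- t p)) ->
  exists2 r, r != 0 & forall p, V p ->
    y1 p = r * (expR (lam p) * hcos c (t p)) /\ y2 p = r * (expR (lam p) * hsin c (t p)).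
Proof.
move=> st pt qE; pose r := light_plus base * expR (- t base).
exists r => [|p Vp].
  by rewrite mulf_neq0 ?light_plus_neq0// gt_eqF ?expR_gt0.
have pE := exponential_solution V_open V_connected
  (fun p Vp => (light_differentiable Vp).1) (fun p k Vp => (light_partial k Vp).1)
  (fun p Vp => smooth_differentiable st Vp) (fun p k Vp => pt p Vp k) V_base Vp.
have ee : expR (t p) * expR (- t p) = 1 by rewrite -expRD subrr expR0.
have mE : light_minus p = r * (causal_sign c * expR (- t p)).
  rewrite (qE p Vp) pE -/r.
  transitivity (r * (causal_sign c * expR (- t p)) * (expR (t p) * expR (- t p))).
    by ring.
  by rewrite ee mulr1.
have [-> ->] := product_light p; rewrite hcosE hsinE mE pE -/r.
by split; ring.
Qed.

Lemma proportional_model t r : r != 0 -> smooth V t ->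
  (forall p, V p ->
    y1 p = r * (expR (lam p) * hcos c (t p)) /\ y2 p = r * (expR (lam p) * hsin c (t p))) ->
  proportional V F xi (parallel_model c lam N1 N2 t).
Proof.
move=> r0 st yE; exists r => // i p Vp Fp; have Up : U i p by [].
apply/eqP; rewrite -subr_eq0 -scaleNr; apply/eqP.
have [e1 e2] := yE p Vp.
have inn (Y : field N) : inner (metric i (chart i (F p)))
    (xi i p + - r *: parallel_model c lam N1 N2 t i p) (Y i p)
    = h_along F xi Y i p - r * h_along F (parallel_model c lam N1 N2 t) Y i p.
  by rewrite innerDl innerZl mulNr.
apply: (frame_eq0 Up).
- rewrite (inn (tangent F 0)) (parallel_is_normal Vp Fp 0) (model_normal c t Vp Fp 0).
  by rewrite mulr0 subrr.
- rewrite (inn (tangent F 1)) (parallel_is_normal Vp Fp 1) (model_normal c t Vp Fp 1).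
  by rewrite mulr0 subrr.
- rewrite (inn N1) (model_N1 c t Up) -e1 (productE parallel_field N1_field Vp Fp).
  by rewrite subrr.
- rewrite (inn N2) (model_N2 c t Up) -e2 (productE parallel_field N2_field Vp Fp).
  by rewrite subrr.
Qed.

(** The null coordinates of xi solve d_k p = mu_k p and d_k q = - mu_k q, and
    the sign of p q is that of the norm of xi. They are therefore r exp t and +-
    r exp (- t) for a constant r and an angle t with gradient mu. *)
Lemma parallel_angle : exists t, [/\ smooth V t,
  forall p, V p -> forall k, partial k t p = mu k p,
  forall p, V p -> forall j, hcos c (t p) * al p 0 j + hsin c (t p) * be p 0 j = 0 &
  proportional V F xi (parallel_model c lam N1 N2 t)].
Proof.
have [t [dt tE]] := angle_function (fun p Vp => (light_differentiable Vp).1)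
  (fun p k Vp => (light_partial k Vp).1)
  (fun p Vp => (light_differentiable Vp).2) (fun p k Vp => (light_partial k Vp).2)
  light_sign.
have pt p (Vp : V p) k : partial k t p = mu k p by have [_] := dt p Vp; exact.
have st : smooth V t.
  apply: smooth_of_partial => [p Vp|k]; first by have [] := dt p Vp.
  move=> s; apply: (@eq_Cr _ _ _ _ _ (mu k)) => // [p Vp|]; first by rewrite pt.
  have [s1 s2 _] := N12_conn.
  by elim/forall_ord2: k; [exact: s1|exact: s2].
have [r r0 yE] := proportional_to_model st pt tE.
exists t; split => //; last exact: proportional_model yE.
move=> p Vp j; have [e1 e2] := yE p Vp; have := parallel_dependent j Vp; rewrite e1 e2.
have w0 : r * expR (lam p) != 0 by rewrite mulf_neq0// gt_eqF ?expR_gt0.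
by move=> H; apply: (mulfI w0); rewrite mulr0 -[RHS]H; ring.
Qed.

(** By dependent_partial the angle t has the gradient mu, so only the equality
    of the ratios y1 : y2 and hcos t : hsin t is at stake. Both pairs annihilate
    the second fundamental form; if the ratios differed, it would vanish and the
    Gauss equation would give K = L0. *)
Lemma dependent_proportional t : smooth V t ->
  (forall p, V p -> forall j, hcos c (t p) * al p 0 j + hsin c (t p) * be p 0 j = 0) ->
  (forall p, V p -> gauss_curvature (lorentz_metric lam) p != L0) ->
  proportional V F xi (parallel_model c lam N1 N2 t).
Proof.
move=> st dep KL; have pt p (Vp : V p) := dependent_partial st dep Vp (KL p Vp).
have tE p : V p -> light_minus p
    = causal_sign c * light_plus p * expR (- t p) * expR (- t p).
  move=> Vp.
  (* Equality of the two ratios; otherwise both coefficient vectors would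
     be in the kernel of an invertible matrix of order 2. *)
  have cross : y1 p * hsin c (t p) = y2 p * hcos c (t p).
    apply/eqP; apply: contraNT (KL p Vp) => cr.
    have zero j : al p 0 j = 0 /\ be p 0 j = 0.
      have d1 := parallel_dependent j Vp; have d2 := dep p Vp j.
      rewrite -subr_eq0 in cr.
      split; apply: (mulfI cr); rewrite mulr0.
        transitivity (hsin c (t p) * (y1 p * al p 0 j + y2 p * be p 0 j)
          - y2 p * (hcos c (t p) * al p 0 j + hsin c (t p) * be p 0 j)); first by ring.
        by rewrite d1 d2; ring.
      transitivity (y1 p * (hcos c (t p) * al p 0 j + hsin c (t p) * be p 0 j)
        - hcos c (t p) * (y1 p * al p 0 j + y2 p * be p 0 j)); first by ring.
      by rewrite d1 d2; ring.
    have E0 : E p != 0 by rewrite gt_eqF ?expR_gt0.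
    rewrite -subr_eq0 -(inj_eq (mulIf E0)) (gauss_relation Vp).
    by rewrite !(zero _).1 !(zero _).2 expr0n mul0r !subr0 addr0 mul0r.
  have ee : expR (t p) * expR (- t p) = 1 by rewrite -expRD subrr expR0.
  have [l1 l2] := product_light p.
  have w0 : expR (lam p) != 0 by rewrite gt_eqF ?expR_gt0.
  move: cross; rewrite l1 l2 hcosE hsinE => cross.
  have bal : light_minus p * expR (t p) = causal_sign c * light_plus p * expR (- t p).
    by apply: (mulfI w0); move: cross; lra.
  by rewrite -bal -mulrA ee mulr1.
have [r r0 yE] := proportional_to_model st pt tE.
exact: proportional_model yE.
Qed.

End ParallelFields.

Lemma constant_difference (f t : 'rV[R]_2 -> R) : connected V -> (exists p, V p) ->
  (forall p, V p -> differentiable f p) -> smooth V t ->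
  (forall p, V p -> forall k, partial k f p = mu k p) ->
  (forall p, V p -> forall k, partial k t p = mu k p) ->
  constant_on V (fun q => f q - t q).
Proof.
move=> cV [p0 V0] df st pf pt; exists (f p0 - t p0) => p Vp.
have dt q (Vq : V q) := smooth_differentiable st Vq.
have dd q : V q -> differentiable (fun q => f q - t q) q.
  by move=> Vq; exact: differentiableB (df q Vq) (dt q Vq).
have pd q k : V q -> partial k (fun q => f q - t q) q = 0.
  move=> Vq; have -> : partial k (fun q => f q - t q) q = partial k f q - partial k t q.
    exact: (deriveB (diff_derivable (df q Vq)) (diff_derivable (dt q Vq))).
  by rewrite pf// pt// subrr.
exact: (constant_of_partial0 V_open cV dd pd V0 Vp).
Qed.

Lemma partial_of_constant_difference (f t : 'rV[R]_2 -> R) :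
  (forall p, V p -> differentiable f p) -> smooth V t ->
  (forall p, V p -> forall k, partial k f p = mu k p) ->
  constant_on V (fun q => f q - t q) ->
  forall p, V p -> forall k, partial k t p = mu k p.
Proof.
move=> df st pf [a fa] p Vp k.
have dt := smooth_differentiable st Vp.
have : partial k (fun q => f q - t q) p = 0.
  by rewrite (eq_partial k V_open Vp fa) partial_constant.
have -> : partial k (fun q => f q - t q) p = partial k f p - partial k t p.
  exact: (deriveB (diff_derivable (df p Vp)) (diff_derivable dt)).
by rewrite pf// => /eqP; rewrite subr_eq0 => /eqP.
Qed.

Lemma linearly_dependentP c t : linearly_dependent c V al be t <->
  smooth V t /\
  (forall p, V p -> forall j, hcos c (t p) * al p 0 j + hsin c (t p) * be p 0 j = 0).
Proof.
have vec p : hcos c (t p) *: al p + hsin c (t p) *: be p = 0 <->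
    forall j, hcos c (t p) * al p 0 j + hsin c (t p) * be p 0 j = 0.
  split=> [/rowP H j|H]; first by have := H j; rewrite !mxE.
  by apply/rowP => j; rewrite !mxE.
split=> -[st H]; split => // p Vp.
  by apply/vec; have := H p Vp; case: c {vec H}.
by have /vec := H p Vp; case: c {vec H}.
Qed.

End Surfaces.

(** * The theorem *)

Theorem theorem4p1 (R : realType) (L0 : R) (N : pseudoRiemannian R 4)
  (hN : neutral_space_form N L0)
  (D : set 'rV[R]_2) (D_open : open D) (D_connected : connected D)
  (D_simply_connected : simply_connected D)
  (F : 'rV[R]_2 -> N) (lambda : 'rV[R]_2 -> R)
  (hF : timelike_conformal_immersion D F lambda)
  (N1 N2 : field N) (hN12 : normal_frame D F lambda N1 N2)
  (alpha beta : 'rV[R]_2 -> 'rV[R]_3)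
  (hsigma : second_form_coefficients D F lambda N1 N2 alpha beta)
  (mu1 mu2 : 'rV[R]_2 -> R)
  (hmu : normal_connection_coefficients D F lambda N1 N2 mu1 mu2)
  (hflat : flat_normal_connection D F (lorentz_metric lambda)) :
  let K := gauss_curvature (lorentz_metric lambda) in
  ((forall p, D p -> K p != L0) ->
   forall p V, open V -> connected V -> V p -> V `<=` D ->
   forall c : causal,
     [/\ (exists xi, parallel_normal_of c V F xi) <->
           (exists t, linearly_dependent c V alpha beta t),
         forall gamma, potential D mu1 mu2 gamma ->
           forall t, linearly_dependent c V alpha beta t ->
             constant_on V (fun q => gamma q - t q) &
         forall xi, parallel_normal_of c V F xi ->
           forall t, linearly_dependent c V alpha beta t ->
             proportional V F xi (parallel_model c lambda N1 N2 t)])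
  /\
  ((forall p, D p -> K p = L0) ->
   forall gamma, potential D mu1 mu2 gamma ->
   forall p V, open V -> connected V -> V p -> V `<=` D ->
   forall c : causal,
     ((exists xi, parallel_normal_of c V F xi) <->
        (exists t, linearly_dependent c V alpha beta t /\
                   constant_on V (fun q => gamma q - t q))) /\
     (forall xi, parallel_normal_of c V F xi ->
        exists t, [/\ linearly_dependent c V alpha beta t,
                      constant_on V (fun q => gamma q - t q) &
                      proportional V F xi (parallel_model c lambda N1 N2 t)])).
Proof.
move=> K.
have [_ curv] := hN.
have potential_partial gamma : potential D mu1 mu2 gamma -> forall V, V `<=` D ->
    (forall q, V q -> differentiable gamma q) /\
    (forall q, V q -> forall k, partial k gamma q = connection_pair mu1 mu2 k q).
  move=> [sg pg] V VD; split=> q /VD Dq; first exact: smooth_differentiable sg Dq.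
  by have [g1 g2] := pg q Dq; elim/forall_ord2.
split=> [KL p V oV cV Vp VD c|_ gamma gam p V oV cV Vp VD c].
  have imm := subset_immersion VD hF.
  have fr := subset_normal_frame VD hN12.
  have sg := subset_second_form VD hsigma.
  have cn := subset_connection VD hmu.
  have KV q (Vq : V q) := KL q (VD q Vq).
  have pt t : linearly_dependent c V alpha beta t ->
      forall q, V q -> forall k, partial k t q = connection_pair mu1 mu2 k q.
    move=> /linearly_dependentP[st dep] q Vq.
    exact: (dependent_partial curv oV imm fr sg cn st dep Vq (KV q Vq)).
  split.
  - split=> [[xi par]|[t ld]].
      have [t [st _ dep _]] := parallel_angle curv oV imm fr sg cn cV Vp par.
      by exists t; apply/linearly_dependentP.
    have /linearly_dependentP[st dep] := ld.
    exists (parallel_model c lambda N1 N2 t).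
    exact: (model_parallel curv oV imm fr sg cn st dep (pt t ld)).
  - move=> gamma gam t ld; have [st _] := ld.
    have [dg pg] := potential_partial gamma gam V VD.
    exact: (constant_difference oV cV (ex_intro _ p Vp) dg st pg (pt t ld)).
  - move=> xi par t /linearly_dependentP[st dep].
    exact: (dependent_proportional curv oV imm fr sg cn cV Vp par st dep KV).
have imm := subset_immersion VD hF.
have fr := subset_normal_frame VD hN12.
have sg := subset_second_form VD hsigma.
have cn := subset_connection VD hmu.
have [dg pg] := potential_partial gamma gam V VD.
have forward xi : parallel_normal_of c V F xi ->
    exists t, [/\ linearly_dependent c V alpha beta t,
                  constant_on V (fun q => gamma q - t q) &
                  proportional V F xi (parallel_model c lambda N1 N2 t)].
  move=> par; have [t [st pt dep prop]] := parallel_angle curv oV imm fr sg cn cV Vp par.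
  exists t; split => //; first by apply/linearly_dependentP.
  exact: (constant_difference oV cV (ex_intro _ p Vp) dg st pg pt).
split=> //; split=> [[xi /forward[t [ld cst _]]]|[t [ld cst]]]; first by exists t.
have /linearly_dependentP[st dep] := ld.
exists (parallel_model c lambda N1 N2 t).
apply: (model_parallel curv oV imm fr sg cn st dep).
exact: (partial_of_constant_difference oV dg st pg cst).
Qed.
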